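(* Let $H$ be a fixed undirected simple graph with at least three vertices. \begin{itemize} \item If $H$ is $P_3$, $\text{co-}P_3$ or $P_4$, then there is $q=\tilde O(1)$ such that $D^{q}(\textsc{IndSub}(H))=\tilde O(n)$. \item Otherwise, $R^p_{2/3}(\textsc{IndSub}(H))=\Omega(n^2/p)$. \end{itemize}
   Context: Insertion-only graph streaming model: the edges of an $n$-vertex input graph arrive as a stream in arbitrary order; the algorithm knows $n$, may scan the stream from beginning to end $p$ times (passes), and has $S$ bits of memory. $\textsc{IndSub}(H)$: given an $n$-vertex undirected simple graph $G$ (as a stream) and a fixed pattern graph $H$ (at least three vertices, possibly disconnected), decide whether $G$ contains $H$ as an induced subgraph, and if so output the vertex set of such a copy. $R^p_{2/3}(\Pi)$ is the minimum space of a randomized $p$-pass streaming algorithm solving $\Pi$ with success probability at least $2/3$; $D^p(\Pi)$ is the minimum space of a deterministic $p$-pass streaming algorithm solving $\Pi$. $\tilde O$ hides polylogarithmic factors in $n$; asymptotics are as $n\to\infty$ with $H$ fixed, and $p$ may depend on $n$. $P_\ell$ is the path on $\ell$ vertices and $\text{co-}P_\ell$ its complement (so $\text{co-}P_3$ is one edge plus an isolated vertex). *)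

(* Defs.v *)
From mathcomp Require Import all_boot.
Set Implicit Arguments. Unset Strict Implicit. Unset Printing Implicit Defensive.

(* An input stream on n vertices: a duplicate-free list of edges {u,v},
   each written canonically as (u,v) with u < v, in arbitrary order.
   Every simple graph on 'I_n is given by such streams (one per ordering). *)
Definition edge (n : nat) := ('I_n * 'I_n)%type.

Definition valid_stream (n : nat) (s : seq (edge n)) : bool :=
  uniq s && all (fun e : edge n => (e.1 < e.2)%N) s.

Definition gadj (n : nat) (s : seq (edge n)) (u v : 'I_n) : bool :=
  ((u, v) \in s) || ((v, u) \in s).

Definition induced_copy (h : nat) (hE : rel 'I_h) (n : nat)
    (s : seq (edge n)) (V : {set 'I_n}) : Prop :=
  exists f : 'I_h -> 'I_n,
    [/\ injective f, f @: setT = V & forall a b, hE a b = gadj s (f a) (f b)].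

Definition correct_answer (h : nat) (hE : rel 'I_h) (n : nat)
    (s : seq (edge n)) (o : option {set 'I_n}) : Prop :=
  match o with
  | None => ~ (exists V, induced_copy hE s V)
  | Some V => induced_copy hE s V
  end.

Definition path_rel (l : nat) : rel 'I_l :=
  fun i j => (i.+1 == j :> nat) || (j.+1 == i :> nat).
Definition copath_rel (l : nat) : rel 'I_l :=
  fun i j => (i != j) && ~~ path_rel i j.

Definition graph_iso (h l : nat) (E1 : rel 'I_h) (E2 : rel 'I_l) : Prop :=
  exists f : 'I_h -> 'I_l, bijective f /\ forall a b, E1 a b = E2 (f a) (f b).

(* A deterministic p-pass streaming algorithm with S bits of memory on
   n-vertex inputs: its memory is an S-bit string; each stream element
   updates the memory by an arbitrary function (which may depend on the
   pass index and on the position in the stream); after the last pass the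
   output is an arbitrary function of the memory. *)
Record salg (n p S : nat) := SAlg {
  s_init : S.-tuple bool;
  s_step : 'I_p -> nat -> edge n -> S.-tuple bool -> S.-tuple bool;
  s_out  : S.-tuple bool -> option {set 'I_n} }.

Fixpoint pass_from (E St : Type) (f : nat -> E -> St -> St) (t : nat)
    (s : seq E) (st : St) : St :=
  match s with
  | [::] => st
  | e :: s' => pass_from f t.+1 s' (f t e st)
  end.

Definition run (n p S : nat) (A : salg n p S) (s : seq (edge n))
    : option {set 'I_n} :=
  s_out A (foldl (fun st (k : 'I_p) => pass_from (s_step A k) 0 s st)
                 (s_init A) (enum 'I_p)).

Definition det_solves (h : nat) (hE : rel 'I_h) (n p S : nat)
    (A : salg n p S) : Prop :=
  forall s : seq (edge n), valid_stream s -> correct_answer hE s (run A s).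

(* A randomized algorithm = uniformly random seed r among m+1 seeds selecting
   a deterministic S-bit algorithm (random bits are free / public);
   it solves IndSub(H) with probability >= 2/3 on every input stream. *)
Definition rand_solves (h : nat) (hE : rel 'I_h) (n p S : nat) : Prop :=
  exists (m : nat) (A : 'I_m.+1 -> salg n p S),
    forall s : seq (edge n), valid_stream s ->
      exists good : {set 'I_m.+1},
        (2 * m.+1 <= 3 * #|good|)%N /\
        forall r, r \in good -> correct_answer hE s (run (A r) s).

(* Main.v *)
Require Import Defs.
From mathcomp Require Import all_boot.
From mathcomp Require Import zify.
From Stdlib Require Import Classical_Prop.
Set Implicit Arguments. Unset Strict Implicit. Unset Printing Implicit Defensive.

(** Easy cases. P3, co-P3 and P4 are induced subgraphs of P4, so H-free graphs are
    P4-free. These have twins, hence there are only 2^(O(n log n)) of them, and some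
    linear sketch of O(n log n) bits is injective on them. Sketching a prefix of
    the vertex set yields a unique candidate, which one more pass verifies exactly;
    binary search finds the largest H-free prefix, and together with the neighbours
    of the next vertex it contains a copy of H.

    Hard cases. Razborov's rectangle bound gives the linear lower bound for set
    disjointness. By Ramsey's theorem R(3,3) = 6, H or its complement contains a
    triangle, or H is C4, 2K2 or C5. If H has a triangle, take a minimum set S such
    that H - S is triangle-free, s in S, and consider hosts made of S - s, copies of
    H - S and clones of s. When every clone sees at most one vertex of each copy,
    deleting S - s kills all triangles, so the host is H-free; hence some extremal
    step between such hosts and H itself encodes disjointness. *)

(** * Cographs *)

(** The sketch separates H-free graphs only from one another: a prefix that contains H may share its
    sketch with a free one. Uniqueness of the candidate is therefore meaningful only for free
    prefixes, so each round must verify it exactly, and the search aims at a free prefix instead of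
    decoding the whole input. The sketch function exists by counting and is hard-wired for each [n];
    the algorithm stays deterministic and does not store it. In the lower bound, the memory states
    handed over during [p] passes cover the inputs by 2^(O(n + pS)) rectangles per seed, over a
    universe of order n^2 points. For a general H with a triangle no explicit gadget is exhibited.
    The danger is a disjoint instance that contains H in an unforeseen way; such an accidental copy
    is turned into progress, since it places H in a more restricted host. The descent must end in a
    gadget because the most restricted hosts omit H. C4, 2K2 and C5 are out of reach of this
    argument, being triangle-free together with their complements, and receive hand-made
    blow-ups. *)

Section Cographs.
Variable V : finType.
Implicit Types (E : rel V) (A B : {set V}).

Definition p4 E (a b c d : V) : bool :=
  [&& E a b, E b c, E c d & [&& ~~ E a c, ~~ E b d & ~~ E a d]].

Definition p4_free E A : Prop :=
  forall a b c d, a \in A -> b \in A -> c \in A -> d \in A -> ~~ p4 E a b c d.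

(** With [v = false] the graph on [A] is disconnected, with [v = true] its complement is; one notion
    for both makes it invariant under complementation. *)
Definition splits E A : Prop :=
  exists v B, [/\ B \subset A, B != set0, A :\: B != set0 &
    forall b c, b \in B -> c \in A :\: B -> E b c = v].

Definition co_rel E : rel V := fun a b => (a != b) && ~~ E a b.

(** P4 is self-complementary: the complement of the path [a b c d] is the path [c a d b]. *)
Lemma p4_free_co E A : symmetric E -> p4_free E A -> p4_free (co_rel E) A.
Proof.
move=> Es fr a b c d aA bA cA dA; apply/negP; rewrite /p4 /co_rel.
case/and4P=> /andP[ab nab] /andP[bc nbc] /andP[cd ncd] /and3P[].
have [e|ac] /= := eqVneq a c.
  by move=> _ _; rewrite e cd ncd.
have [e|bd] /= := eqVneq b d.
  by move=> _ _; rewrite -e ab nab.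
have [e|ad] /= := eqVneq a d.
  by rewrite !negbK; rewrite (Es c d) -e in ncd; rewrite (negbTE ncd).
rewrite !negbK => eac ebd ead; have := fr c a d b cA aA dA bA.
by rewrite /p4 (Es c a) eac ead (Es d b) ebd ncd nab (Es c b) nbc.
Qed.

Lemma splits_co E A : splits (co_rel E) A -> splits E A.
Proof.
move=> [v [B [sB B0 C0 e]]]; exists (~~ v), B; split=> // b c bB cC.
have bc : b != c by apply: contraTneq cC => <-; rewrite inE bB.
by rewrite -(e b c bB cC) /co_rel bc negbK.
Qed.

(* If A \ w splits without cross edges and w sees part of B but not all of it,
   then P4-freeness forbids edges inside B between neighbours and non-neighbours
   of w, so the non-neighbours in B split off. *)
Lemma split_add_vertex E A w B : symmetric E -> p4_free E A -> w \in A ->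
  B \subset A :\ w -> B != set0 -> A :\ w :\: B != set0 ->
  (forall b c, b \in B -> c \in A :\ w :\: B -> E b c = false) -> splits E A.
Proof.
move=> Es fr wA sB B0 C0 noE.
have key (X Y : {set V}) : X \subset A :\ w -> Y \subset A :\ w ->
    (forall b c, b \in X -> c \in Y -> E b c = false) ->
    (forall a, a \in A :\ w -> a \in X \/ a \in Y) ->
    [exists z in Y, E w z] -> [exists y in X, ~~ E w y] -> splits E A.
  move=> sX sY XY cov /exists_inP[z zY wz] /exists_inP[y yX wy].
  pose M := [set a in X | ~~ E w a].
  exists false, M; split.
  - by apply/subsetP => a; rewrite inE => /andP[/(subsetP sX)]; rewrite !inE => /andP[].
  - by apply/set0Pn; exists y; rewrite inE yX.
  - apply/set0Pn; exists w; rewrite !inE wA andbT negb_and.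
    by apply/orP; left; apply/negP => /(subsetP sX); rewrite !inE eqxx.
  move=> b c; rewrite !inE => /andP[bX nwb] /andP[nM cA].
  have [->|cw] := eqVneq c w; first by rewrite Es (negbTE nwb).
  have cA' : c \in A :\ w by rewrite !inE cw.
  case: (cov c cA') => [cX|cY]; last exact: XY.
  rewrite cX /= negbK in nM; apply/negP => bc.
  have inA (X' : {set V}) a : X' \subset A :\ w -> a \in X' -> a \in A.
    by move=> s /(subsetP s); rewrite !inE => /andP[].
  have := fr b c w z (inA _ _ sX bX) cA wA (inA _ _ sY zY).
  by rewrite /p4 bc (Es c w) nM wz (Es b w) nwb (XY c z) // (XY b z).
set C := A :\ w :\: B in C0 noE.
have sC : C \subset A :\ w by apply: subsetDl.
have cov a : a \in A :\ w -> a \in B \/ a \in C.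
  by move=> aA; rewrite [a \in C]inE aA andbT; case: (a \in B); [left|right].
have cov' a : a \in A :\ w -> a \in C \/ a \in B by move/cov => []; [right|left].
have noE' b c : b \in C -> c \in B -> E b c = false by rewrite Es => ? ?; apply: noE.
have lone (X Y : {set V}) : X \subset A :\ w -> X != set0 ->
    (forall b c, b \in X -> c \in Y -> E b c = false) ->
    (forall a, a \in A :\ w -> a \in X \/ a \in Y) ->
    ~~ [exists z in X, E w z] -> splits E A.
  move=> sX X0 XY cv nx; exists false, X; split=> //.
  - by apply: subset_trans sX _; apply: subsetDl.
  - apply/set0Pn; exists w; rewrite !inE wA andbT.
    by apply/negP => /(subsetP sX); rewrite !inE eqxx.
  move=> b c bX; rewrite inE => /andP[cX cA].
  have [->|cw] := eqVneq c w.
    by rewrite Es; apply: contraNF nx => wb; apply/exists_inP; exists b.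
  by case: (cv c) => [|cX'|]; [rewrite !inE cw|rewrite cX' in cX|apply: XY].
case: (boolP [exists z in B, E w z]) => [wB|]; last exact: (lone B C).
case: (boolP [exists z in C, E w z]) => [wC|]; last exact: (lone C B).
case: (boolP [exists y in B, ~~ E w y]) => [nB|nB]; first exact: (key B C).
case: (boolP [exists y in C, ~~ E w y]) => [nC|nC]; first exact: (key C B).
(* Here [w] is adjacent to everything in [B] and [C], so it is isolated in the complement. *)
exists true, [set w]; split.
- by rewrite sub1set.
- by apply/set0Pn; exists w; rewrite inE.
- by have /set0Pn[b bB] := B0; apply/set0Pn; exists b; apply: (subsetP sB).
move=> b c; rewrite inE => /eqP -> /cov[] cX; apply: contraT => nwc.
  by case/exists_inP: nB; exists c.
by case/exists_inP: nC; exists c.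
Qed.

Lemma p4_free_sub E A B : B \subset A -> p4_free E A -> p4_free E B.
Proof. by move=> /subsetP sB fr a b c d ? ? ? ?; apply: fr; apply: sB. Qed.

(** Seinsche's theorem, by deleting a vertex [w]: [split_add_vertex] treats a disconnected [A :\ w],
    and the co-disconnected case is the same lemma in the complement. *)
Lemma p4_free_splits E A : symmetric E -> p4_free E A -> 1 < #|A| -> splits E A.
Proof.
move=> Es fr; have [m] := ubnP #|A|; elim: m A fr => // m IH A fr Am A1.
have [w wA] : exists w, w \in A by apply/set0Pn; rewrite -card_gt0; lia.
have cA := cardsD1 w A; rewrite wA in cA.
have sA : A :\ w \subset A by apply: subsetDl.
have [A2|A2] := leqP #|A :\ w| 1.
  have /cards1P[z ez] : #|A :\ w| == 1 by apply/eqP; lia.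
  exists (E w z), [set w]; rewrite ez; split.
  - by rewrite sub1set.
  - by apply/set0Pn; exists w; rewrite inE.
  - by apply/set0Pn; exists z; rewrite inE.
  by move=> b c; rewrite !inE => /eqP -> /eqP ->.
have [|v [B [sB B0 C0 e]]] := IH (A :\ w) (p4_free_sub sA fr) _ A2; first by lia.
case: v e => e; last exact: (split_add_vertex Es fr wA sB B0 C0 e).
apply: splits_co; apply: (split_add_vertex _ (p4_free_co Es fr) wA sB B0 C0).
  by move=> a b; rewrite /co_rel eq_sym Es.
by move=> b c bB cC; rewrite /co_rel e // andbF.
Qed.

(** Vertices outside one side of a split see that side uniformly, so twins found inside a side
    remain twins in [A]. If both sides are singletons, these two vertices are the twins. *)
Lemma p4_free_twins E A : symmetric E -> p4_free E A -> 1 < #|A| ->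
  exists u v, [/\ u \in A, v \in A, u != v &
    forall w, w \in A -> w != u -> w != v -> E w u = E w v].
Proof.
move=> Es fr; have [m] := ubnP #|A|; elim: m A fr => // m IH A fr Am A1.
have [v [B [sB B0 C0 e]]] := p4_free_splits Es fr A1.
have sC : A :\: B \subset A by apply: subsetDl.
have cA : #|B| + #|A :\: B| = #|A| by rewrite -(cardsID B A) (setIidPr sB).
rewrite -!card_gt0 in B0 C0.
have go (X : {set V}) c : X \subset A -> #|X| < #|A| -> 1 < #|X| ->
    (forall w x, w \in A -> w \notin X -> x \in X -> E w x = c) ->
    exists u v, [/\ u \in A, v \in A, u != v &
      forall w, w \in A -> w != u -> w != v -> E w u = E w v].
  move=> sX Xm X1 out; have [|x [y [xX yX xy tw]]] := IH X (p4_free_sub sX fr) _ X1; first by lia.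
  exists x, y; split; rewrite ?(subsetP sX) // => w wA wx wy.
  by case: (boolP (w \in X)) => wX; [exact: tw | rewrite !out].
have [B1|B1] := ltnP 1 #|B|.
  apply: (go B v) => //; first by lia.
  by move=> w x wA wB xB; rewrite Es e // inE wB.
have [C1|C1] := ltnP 1 #|A :\: B|.
  apply: (go (A :\: B) v) => //; first by lia.
  by move=> w x wA; rewrite inE wA andbT negbK => wB xB; rewrite e.
have /cards1P[x ex] : #|B| == 1 by rewrite eqn_leq B1.
have /cards1P[y ey] : #|A :\: B| == 1 by rewrite eqn_leq C1.
have xB : x \in B by rewrite ex inE.
have yC : y \in A :\: B by rewrite ey inE.
exists x, y; split; [exact: (subsetP sB)|exact: (subsetP sC)| |].
  by apply: contraTneq yC => <-; rewrite inE xB.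
move=> w wA wx wy; have : w \in A :\: B by rewrite inE wA ex inE wx.
by rewrite ey inE (negbTE wy).
Qed.

(* Read from the tail: each triple (u, v, b) re-inserts u as a twin of v, with
   adjacency b between them; (u, u, false) changes nothing and serves as padding. *)
Fixpoint twin_graph (s : seq (V * V * bool)) : rel V :=
  if s is (u, v, b) :: s' then
    fun x y =>
      if x == u then (if y == u then false else if y == v then b else twin_graph s' v y)
      else if y == u then (if x == v then b else twin_graph s' x v)
      else twin_graph s' x y
  else fun _ _ => false.

Lemma p4_free_code E A : symmetric E -> irreflexive E -> p4_free E A -> A != set0 ->
  exists s, size s = #|A|.-1 /\ {in A &, E =2 twin_graph s}.
Proof.
move=> Es Ei fr; have [m] := ubnP #|A|; elim: m A fr => // m IH A fr Am A0.
have [A1|A1] := leqP #|A| 1.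
  exists [::]; have /cards1P[z ->] : #|A| == 1 by rewrite eqn_leq A1 card_gt0.
  by rewrite cards1; split=> // x y; rewrite !inE => /eqP -> /eqP ->; rewrite Ei.
have [u [v [uA vA uv tw]]] := p4_free_twins Es fr A1.
have cA := cardsD1 u A; rewrite uA in cA.
have sA : A :\ u \subset A by apply: subsetDl.
have [||s [ss es]] := IH (A :\ u) (p4_free_sub sA fr); first by lia.
  by rewrite -card_gt0; lia.
exists ((u, v, E u v) :: s); split; first by rewrite /= ss; lia.
have inA x : x \in A -> x != u -> x \in A :\ u by move=> xA xu; rewrite !inE xu.
have vA' : v \in A :\ u by apply: inA; rewrite // eq_sym.
move=> x y xA yA /=; have [->|xu] := eqVneq x u.
  have [->|yu] := eqVneq y u; first by rewrite Ei.
  have [->//|yv] := eqVneq y v.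
  by rewrite -es ?vA' ?inA // (Es u) (Es v) tw.
have [->|yu] := eqVneq y u; last by rewrite es ?inA.
have [->|xv] := eqVneq x v; first by rewrite Es.
by rewrite -es ?vA' ?inA // tw.
Qed.

Lemma twin_graph_pad u k s x y : twin_graph s u u = false ->
  twin_graph (nseq k (u, u, false) ++ s) x y = twin_graph s x y.
Proof.
move=> uu; elim: k x y => //= k IH x y; rewrite !IH.
have [->|xu] := eqVneq x u; first by have [->|] := eqVneq y u.
by have [->|] := eqVneq y u.
Qed.

(** Padding to a fixed length turns codes into a finite type of size [(2 * #|V| ^ 2) ^ #|V|], the
    count behind the sketch. *)
Lemma p4_free_tuple E A (x0 : V) : symmetric E -> irreflexive E -> p4_free E A ->
  exists s : #|V|.-tuple (V * V * bool), {in A &, E =2 twin_graph s}.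
Proof.
move=> Es Ei fr; have [A0|A0] := eqVneq A set0.
  by exists [tuple of nseq #|V| (x0, x0, false)] => x y; rewrite A0 inE.
have [s [ss es]] := p4_free_code Es Ei fr A0.
have /set0Pn[u uA] := A0.
have sz : size (nseq (#|V| - size s) (u, u, false) ++ s) == #|V|.
  rewrite size_cat size_nseq subnK // ss.
  by apply: leq_trans (leq_pred _) (max_card _).
exists (Tuple sz) => x y xA yA; rewrite twin_graph_pad ?es //.
by rewrite -es // Ei.
Qed.
End Cographs.

(** * Injective sketches *)

Section Sketch.
Variables (U I : finType) (D : I -> {set U}) (M : nat).

(* Sketches live in Z/M: if A <> B, a fixed e0 in the symmetric difference and
   the values of r off e0 leave at most one value r e0 giving a collision. *)
Definition collision (r : {ffun U -> 'I_M}) (A B : {set U}) : bool :=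
  (\sum_(e in A) r e == \sum_(e in B) r e %[mod M]).

Lemma card_collision (A B : {set U}) : A != B ->
  M * #|[set r | collision r A B]| <= #|{ffun U -> 'I_M}|.
Proof.
wlog [e0 e0A e0B] : A B / exists2 e, e \in A & e \notin B => [gen|] AB.
  have [sAB|/subsetPn ex] := boolP (A \subset B); last exact: gen.
  have ex : exists2 e, e \in B & e \notin A.
    by apply/subsetPn; apply: contra AB => sBA; rewrite eqEsubset sAB.
  have := gen B A ex; rewrite eq_sym => /(_ AB); congr (_ * _ <= _).
  by apply: eq_card => r; rewrite !inE /collision eq_sym.
(* Overwriting [r e0] by a free value loses nothing on colliding [r], where the other values
   determine [r e0]; this injectivity yields the factor [M]. *)
pose upd (p : {ffun U -> 'I_M} * 'I_M) : {ffun U -> 'I_M} :=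
  [ffun e => if e == e0 then p.2 else p.1 e].
have -> : M * #|[set r | collision r A B]| = #|setX [set r | collision r A B] [set: 'I_M]|.
  by rewrite cardsX cardsT card_ord mulnC.
rewrite -(card_in_imset (f := upd)) ?max_card // => -[r c] [r' c'].
rewrite !inE !andbT /= => cr cr' /ffunP e.
have off u : u != e0 -> r u = r' u by move=> ue; have := e u; rewrite !ffunE (negbTE ue).
have -> : c = c' by have := e e0; rewrite !ffunE eqxx.
congr (_, _); apply/ffunP => u; have [->|] := eqVneq u e0; last exact: off.
have eB : \sum_(u in B) r u = \sum_(u in B) r' u.
  by apply: eq_bigr => v vB; rewrite off //; apply: contraTneq vB => ->.
have eA : \sum_(u in A | u != e0) r u = \sum_(u in A | u != e0) r' u.
  by apply: eq_bigr => v /andP[_ ve]; rewrite off.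
move: cr cr'; rewrite /collision !(bigD1 e0 e0A) /= eA -eB => /eqP <-.
by rewrite eq_sym eqn_modDr !modn_small // => /eqP/val_inj.
Qed.

(** Union bound: each of the [#|I| * #|I|] pairs spoils at most a fraction [1 / M] of all
    functions. *)
Lemma sketch_exists : #|I| * #|I| < M ->
  exists r : {ffun U -> 'I_M}, forall i j, collision r (D i) (D j) -> D i = D j.
Proof.
move=> IM; have M0 : 0 < M by apply: leq_trans IM.
have R0 : 0 < #|{ffun U -> 'I_M}| by rewrite card_ffun card_ord expn_gt0 M0.
pose bad (p : I * I) := [set r | (D p.1 != D p.2) && collision r (D p.1) (D p.2)].
have [r rP] : exists r : {ffun U -> 'I_M}, r \notin \bigcup_p bad p.
  apply/existsP; rewrite -negb_forall; apply/negP => /forallP all_bad.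
  have : #|{ffun U -> 'I_M}| <= \sum_p #|bad p|.
    under eq_bigr => p _ do rewrite -sum1_card big_mkcond /=.
    rewrite exchange_big -sum1_card leq_sum //= => r _.
    by have /bigcupP[p _ rp] := all_bad r; rewrite (bigD1 p) //= rp.
  have : M * \sum_p #|bad p| <= #|I| * #|I| * #|{ffun U -> 'I_M}|.
    rewrite -card_prod -sum_nat_const big_distrr leq_sum //= => p _.
    case: (eqVneq (D p.1) (D p.2)) => [e|ne].
      by rewrite (_ : bad p = set0) ?cards0 ?muln0 //; apply/setP => r; rewrite !inE e eqxx.
    rewrite (_ : bad p = [set r | collision r (D p.1) (D p.2)]) ?card_collision //.
    by apply/setP => r; rewrite !inE ne.
  by nia.
exists r => i j c; apply/eqP; apply: contraNT rP => ne.
by apply/bigcupP; exists (i, j); rewrite ?inE //= ne.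
Qed.
End Sketch.

(** * Multi-pass algorithms *)

Lemma encode_state (St : finType) (x0 : St) (S : nat) : #|St| <= 2 ^ S ->
  exists (enc : St -> S.-tuple bool) (dec : S.-tuple bool -> St), cancel enc dec.
Proof.
move=> le; have cT : size (enum {: S.-tuple bool}) = 2 ^ S.
  by rewrite -cardE card_tuple card_bool.
pose enc (x : St) := nth (nseq_tuple S false) (enum {: S.-tuple bool}) (enum_rank x).
exists enc, (fun y => odflt x0 [pick x | enc x == y]) => x.
case: pickP => [z|/(_ x)]; last by rewrite eqxx.
have lt (y : St) : enum_rank y < size (enum {: S.-tuple bool}).
  by rewrite cT; apply: leq_trans le.
rewrite /enc nth_uniq ?enum_uniq ?lt //= => /eqP/val_inj.
exact: enum_rank_inj.
Qed.

Lemma salg_of_machine n q S (St : finType) (st0 : St)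
    (step : nat -> nat -> edge n -> St -> St) (out : St -> option {set 'I_n}) :
  #|St| <= 2 ^ S ->
  exists A : salg n q S, forall s,
    run A s = out (foldl (fun st k => pass_from (step k) 0 s st) st0 (iota 0 q)).
Proof.
move=> /(encode_state st0)[enc [dec encK]].
exists (SAlg (enc st0) (fun (k : 'I_q) t e w => enc (step k t e (dec w)))
             (fun w => out (dec w))) => s.
rewrite /run /= -val_enum_ord.
have pass k t st : pass_from (fun t e w => enc (step k t e (dec w))) t s (enc st)
    = enc (pass_from (step k) t s st).
  by elim: s t st => //= e s IH t st; rewrite encK IH.
elim: (enum 'I_q) st0 => [|k ks IH] st0 /=; first by rewrite encK.
by rewrite pass IH.
Qed.

(* A memory that is updated only between passes plus an accumulator reset at
   the start of each pass. Updates are triggered by the first edge of a pass, so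
   the state None means that the stream was empty. *)
Section Adaptive.
Variables (n : nat) (Mem Acc : finType) (mem0 : Mem) (acc0 : Acc).
Variables (acc : nat -> Mem -> Acc -> edge n -> Acc) (upd : nat -> Mem -> Acc -> Mem).

Definition stat k m s : Acc := foldl (acc k m) acc0 s.
Fixpoint memory s k : Mem :=
  if k is k'.+1 then upd k (memory s k') (stat k' (memory s k') s) else mem0.

(** There is one pass more than updates: the update after a pass is executed at the first edge of
    the next, so the last accumulator goes straight to [out]. *)
Lemma adaptive_alg q S (out : Mem -> Acc -> option {set 'I_n}) :
  #|{: option (Mem * Acc)}| <= 2 ^ S ->
  exists A : salg n q.+1 S, forall s,
    run A s = out (memory s q) (stat q (memory s q) s).
Proof.
pose step k t e (st : option (Mem * Acc)) : option (Mem * Acc) :=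
  if t == 0 then
    let m := if st is Some (m, a) then upd k m a else mem0 in
    Some (m, acc k m acc0 e)
  else if st is Some (m, a) then Some (m, acc k m a e) else None.
pose result s := out (memory s q) (stat q (memory s q) s).
move=> /(salg_of_machine q.+1 None step
  (fun st => if st is Some (m, a) then out m a else result [::]))[A runA].
exists A => -[|e s]; rewrite runA.
  by rewrite (_ : foldl _ _ _ = None) //; elim: (iota _ _).
have tail k t u m a : pass_from (step k) t.+1 u (Some (m, a)) = Some (m, foldl (acc k m) a u).
  by elim: u t a => //= f u IH t a; rewrite IH.
suff -> : foldl (fun st k => pass_from (step k) 0 (e :: s) st) None (iota 0 q.+1)
   = Some (memory (e :: s) q, stat q (memory (e :: s) q) (e :: s)) by [].
elim: q {A runA result} => [|q IH]; first by rewrite /= tail.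
rewrite -addn1 iotaD foldl_cat IH /= add0n.
by rewrite tail.
Qed.
End Adaptive.

(** * Searching for the largest free prefix *)

Definition embeds_in_p4 (h : nat) (hE : rel 'I_h) : Prop :=
  exists g : 'I_h -> 'I_4, injective g /\ forall a b, hE a b = path_rel (g a) (g b).

Section Prefixes.
Variables (h : nat) (hE : rel 'I_h) (n : nat).
Implicit Types (G : {set edge n}) (t : nat).

Definition edge_rel G : rel 'I_n := fun u v => ((u, v) \in G) || ((v, u) \in G).
Definition lower t G : {set edge n} := [set e in G | e.2 < t].
Definition oriented G : bool := [forall e in G, e.1 < e.2].

(* The vertices of the copy are required to be < t: an isolated vertex of H must
   not be matched to a vertex whose edges have been discarded. *)
Definition find_copy t G : option {set 'I_n} :=
  if [pick f : {ffun 'I_h -> 'I_n} | [&& injectiveb f, [forall a, f a < t]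
        & [forall a, forall b, hE a b == edge_rel G (f a) (f b)]]] is Some f
  then Some (f @: setT) else None.

Lemma edge_rel_sym G : symmetric (edge_rel G).
Proof. by move=> u v; rewrite /edge_rel orbC. Qed.

Lemma edge_rel_irr G : oriented G -> irreflexive (edge_rel G).
Proof.
move=> /forall_inP oG u; rewrite /edge_rel orbb; apply/negP => /oG.
by rewrite ltnn.
Qed.

Lemma edge_rel_lower t G (u v : 'I_n) : u < t -> v < t ->
  edge_rel (lower t G) u v = edge_rel G u v.
Proof. by move=> ut vt; rewrite /edge_rel !inE /= ut vt !andbT. Qed.

Lemma find_copy_lower t G : find_copy t (lower t G) = find_copy t G.
Proof.
rewrite /find_copy; congr (if _ is Some f then _ else _); apply: eq_pick => f.
case: (injectiveb f) => //=; case: (boolP [forall a, f a < t]) => //= /forallP ft.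
by apply: eq_forallb => a; apply: eq_forallb => b; rewrite edge_rel_lower.
Qed.

Lemma find_copy_some t G V : find_copy t G = Some V ->
  exists f : 'I_h -> 'I_n, [/\ injective f, f @: setT = V
    & forall a b, hE a b = edge_rel G (f a) (f b)].
Proof.
rewrite /find_copy; case: pickP => // f /and3P[/injectiveP fi _ /forallP fE] [<-].
by exists f; split=> // a b; have /forallP/(_ b)/eqP := fE a.
Qed.

Lemma find_copy_none t G (f : 'I_h -> 'I_n) : find_copy t G = None ->
  injective f -> (forall a, f a < t) ->
  ~ (forall a b, hE a b = edge_rel G (f a) (f b)).
Proof.
rewrite /find_copy; case: pickP => // nof _ fi ft fE.
have := nof (finfun f); move/negP; apply; apply/and3P; split.
- by apply/injectiveP => a b; rewrite !ffunE => /fi.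
- by apply/forallP => a; rewrite ffunE.
- by apply/forallP => a; apply/forallP => b; rewrite !ffunE fE.
Qed.

Lemma find_copy_p4_free t G : embeds_in_p4 hE -> oriented G ->
  find_copy t G = None -> p4_free (edge_rel G) [set v : 'I_n | v < t].
Proof.
move=> [g [gi gE]] oG fn a b c d; rewrite !inE => at_ bt ct dt.
apply/negP => /and4P[ab bc cd /and3P[nac nbd nad]].
pose q (i : 'I_4) := tnth [tuple a; b; c; d] i.
have qE i j : edge_rel G (q i) (q j) = path_rel i j.
  have es := edge_rel_sym G; have ei := edge_rel_irr oG.
  case: i => [[|[|[|[|i]]]] //= li]; case: j => [[|[|[|[|j]]]] //= lj];
  by rewrite /q /tnth /path_rel /= ?ei ?ab ?bc ?cd ?(negbTE nac) ?(negbTE nbd)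
    ?(negbTE nad) // es ?ab ?bc ?cd ?(negbTE nac) ?(negbTE nbd) ?(negbTE nad).
(* Distinct vertices of P4 have distinct neighbourhoods, so the adjacency pattern alone forces [a],
   [b], [c], [d] to be distinct. *)
have qi : injective q.
  move=> i j e; have R k : path_rel i k = path_rel j k by rewrite -!qE e.
  apply: val_inj; move: (R (@Ordinal 4 0 isT)) (R (@Ordinal 4 1 isT))
    (R (@Ordinal 4 2 isT)) (R (@Ordinal 4 3 isT)); rewrite /path_rel /=.
  by case: i {e R} => [[|[|[|[|i]]]] //= li]; case: j => [[|[|[|[|j]]]] //= lj].
apply: (find_copy_none (f := fun x => q (g x)) fn); last by move=> x y; rewrite qE gE.
  by move=> x y /qi/gi.
by move=> x; rewrite /q; case: (g x) => [[|[|[|[|i]]]] //= li].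
Qed.

Definition code := #|'I_n|.-tuple ('I_n * 'I_n * bool).
Definition code_edges (c : code) t : {set edge n} :=
  [set e : edge n | [&& e.1 < e.2, e.2 < t & twin_graph c e.1 e.2]].

Lemma find_copy_code t G : embeds_in_p4 hE -> 0 < n -> oriented G ->
  find_copy t G = None -> exists c, code_edges c t = lower t G.
Proof.
move=> em n0 oG fn.
have [c cE] := p4_free_tuple (Ordinal n0) (edge_rel_sym G) (edge_rel_irr oG)
  (find_copy_p4_free em oG fn).
exists c; apply/setP => -[u v]; rewrite !inE /=.
case: (ltnP v t) => vt; rewrite ?andbF //= andbT.
case: (ltnP u v) => uv /=.
  rewrite -cE ?inE ?(ltn_trans uv) // /edge_rel.
  case: (boolP ((v, u) \in G)) => [vu|_]; rewrite ?orbF //.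
  by move/forall_inP: oG => /(_ _ vu) /=; rewrite ltnNge ltnW.
apply/esym/negP => uvG; move/forall_inP: oG => /(_ _ uvG) /=.
by rewrite ltnNge uv.
Qed.
End Prefixes.

Section Search.
Variables (h : nat) (hE : rel 'I_h) (n L M : nat).
Hypotheses (h0 : 0 < h) (em : embeds_in_p4 hE) (n0 : 0 < n) (nL : n < 2 ^ L).
Hypothesis M0 : 0 < M.
Variable r : {ffun edge n -> 'I_M}.
Hypothesis r_inj : forall (c c' : code n) (t : nat), t <= 2 ^ L ->
  collision r (code_edges c t) (code_edges c' t) -> code_edges c t = code_edges c' t.

(* Memory (t, c, d): c encodes the H-free prefix on the vertices < t found so
   far, d is the candidate code for the next prefix length under test. Pass 2i
   sketches that prefix, pass 2i+1 checks the candidate exactly, and the last pass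
   collects the smaller neighbours of vertex t. *)
Definition memst : finType := ('I_(2 ^ L).+1 * code n * code n)%type.
Definition accu : finType := ('I_M * 'I_(n * n).+1 * bool * {set 'I_n})%type.

Definition threshold (k : nat) (m : memst) : nat := m.1.1 + 2 ^ (L.-1 - k./2).

Definition add_mod (z : 'I_M) (v : nat) : 'I_M := Ordinal (ltn_pmod (z + v) M0).
(** A valid stream has at most [n * n] edges, so the counter never wraps around. *)
Definition incr (z : 'I_(n * n).+1) : 'I_(n * n).+1 :=
  Ordinal (ltn_pmod z.+1 (ltn0Sn (n * n))).

Definition accu_step (k : nat) (m : memst) (a : accu) (e : edge n) : accu :=
  let low := e.2 < threshold k m in
  let: (z, cnt, ok, nb) := a in
  (if low then add_mod z (r e) else z, if low then incr cnt else cnt,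
   ok && (low ==> twin_graph m.2 e.1 e.2),
   if e.2 == m.1.1 :> nat then e.1 |: nb else nb).

Definition accu0 : accu := (Ordinal M0, ord0, true, set0).
Definition code0 : code n := [tuple of nseq _ (Ordinal n0, Ordinal n0, false)].
Definition mem0 : memst := (ord0, code0, code0).

(** Here [k] is the pass about to start, so [a] stems from pass [k.-1]: a sketching pass for odd
    [k], a checking pass for even [k]. A verified candidate is still tested by [find_copy], because
    codes reach all P4-free graphs and these may contain P3 or its complement. *)
Definition mem_upd (k : nat) (m : memst) (a : accu) : memst :=
  let: (t, c, d) := m in let: (z, cnt, ok, _) := a in
  let T := threshold k.-1 m in
  if odd k then
    (t, c, odflt c [pick d' | (\sum_(e in code_edges d' T) r e) %% M == z])
  else if [&& ok, cnt == #|code_edges d T| :> nat & find_copy hE T (code_edges d T) == None]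
  then (inord T, d, d) else m.

Definition answer (m : memst) (a : accu) : option {set 'I_n} :=
  find_copy hE m.1.1.+1
    (code_edges m.1.2 m.1.1 :|: [set e : edge n | (e.1 \in a.2) && (e.2 == m.1.1 :> nat)]).

Section Run.
Variable s : seq (edge n).
Hypothesis vs : valid_stream s.
Let G : {set edge n} := [set e in s].
Let memory_ k := memory mem0 accu0 accu_step mem_upd s k.
Let stat_ k m := stat accu0 accu_step k m s.

Lemma oriented_stream : oriented G.
Proof.
apply/forall_inP => e; rewrite inE => es; have /andP[_ /allP] := vs.
exact.
Qed.

Lemma big_lower T (F : edge n -> nat) : \sum_(e <- s | e.2 < T) F e = \sum_(e in lower T G) F e.
Proof.
have /andP[us _] := vs; rewrite -big_filter [RHS](eq_bigl (mem [seq e : edge n <- s | e.2 < T])).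
  by rewrite -big_uniq ?filter_uniq.
by move=> e; rewrite !inE mem_filter andbC.
Qed.

Lemma stat_spec k m : let: (z, cnt, ok, nb) := stat_ k m in
  [/\ z = (\sum_(e in lower (threshold k m) G) r e) %% M :> nat,
      cnt = #|lower (threshold k m) G| :> nat,
      ok = (lower (threshold k m) G \subset code_edges m.2 (threshold k m))
    & nb = [set u | [exists e in G, (e.1 == u) && (e.2 == m.1.1 :> nat)]]].
Proof.
set T := threshold k m.
have : let: (z, cnt, ok, nb) := stat_ k m in
  [/\ z = (\sum_(e <- s | e.2 < T) r e) %% M :> nat,
      cnt = (\sum_(e <- s | e.2 < T) 1) %% (n * n).+1 :> nat,
      ok = all (fun e : edge n => (e.2 < T) ==> twin_graph m.2 e.1 e.2) s
    & nb = [set u | has (fun e : edge n => (e.1 == u) && (e.2 == m.1.1 :> nat)) s]].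
  rewrite /stat_ /stat; elim/last_ind: (s) => [|s' e IH].
    rewrite /= !big_nil !mod0n; split=> //.
  rewrite -cats1 foldl_cat /= {2}/accu_step -/T.
  move: IH; case: foldl => [[[z cnt] ok] nb] [zE cE okE nbE].
  rewrite !big_cat !big_cons !big_nil /= all_cat /= andbT -okE; split=> //.
  - case: ifP => _ /=; last by rewrite addn0.
    by rewrite zE modnDml addn0.
  - case: ifP => _ /=; last by rewrite addn0.
    by rewrite cE -addn1 modnDml addn0.
  apply/setP => u; rewrite inE has_cat /= orbF.
  have -> : has (fun e0 : edge n => (e0.1 == u) && (e0.2 == m.1.1 :> nat)) s' = (u \in nb).
    by rewrite nbE inE.
  case: (e.2 == _ :> nat); last by rewrite andbF orbF.
  by rewrite !inE andbT eq_sym orbC.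
case: (stat_ k m) => [[[z cnt] ok] nb] [-> -> -> ->]; split.
- by rewrite big_lower.
- rewrite big_lower sum1_card modn_small // ltnS.
  by apply: leq_trans (max_card _) _; rewrite card_prod card_ord.
- have /allP ov := proj2 (andP vs).
  apply/allP/subsetP => H e.
    rewrite !inE => /andP[es eT]; have := H e es; rewrite eT /= => ->.
    by rewrite ov.
  move=> es; apply/implyP => eT; have := H e; rewrite !inE es eT => /(_ isT).
  by case/andP.
apply/setP => u; rewrite !inE; apply/hasP/exists_inP => -[e].
  by move=> es H; exists e; rewrite ?inE.
by rewrite inE => es H; exists e.
Qed.

(** The bracket of a binary search: [m.1.1] is a free length, and the upper end is a length that is
    not free or the sentinel [2 ^ L], which is never tested. *)
Definition search_inv i (m : memst) : Prop :=
  [/\ m.1.1 + 2 ^ (L - i) <= 2 ^ L, find_copy hE m.1.1 G = None,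
      code_edges m.1.2 m.1.1 = lower m.1.1 G
    & m.1.1 + 2 ^ (L - i) = 2 ^ L \/ find_copy hE (m.1.1 + 2 ^ (L - i)) G <> None].

Lemma search_inv0 : search_inv 0 (memory_ 0).
Proof.
split; rewrite /= ?subn0 ?add0n //; last by left.
- rewrite /find_copy; case: pickP => // f /and3P[_ /forallP/(_ (Ordinal h0))].
  by rewrite ltn0.
- by apply/setP => e; rewrite !inE !ltn0 !andbF.
Qed.

Lemma search_inv_step i : i < L ->
  search_inv i (memory_ i.*2) -> search_inv i.+1 (memory_ i.+1.*2).
Proof.
move=> iL; rewrite /memory_ doubleS [memory _ _ _ _ _ _.+2]/= -/(memory_ i.*2).
case: (memory_ i.*2) => [[t c] d] [/= tL tn tc tmax].
set P := 2 ^ (L - i.+1).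
have P2 : 2 ^ (L - i) = P + P.
  by rewrite /P subnS -{1}(prednK (n := L - i)) ?subn_gt0 // expnS mul2n addnn.
have P0 : 0 < P by rewrite expn_gt0.
set T := t + P.
have thr d' : threshold i.*2 (t, c, d') = T /\ threshold i.*2.+1 (t, c, d') = T.
  by rewrite /threshold /= uphalf_double doubleK /T /P; split; congr (_ + 2 ^ _); lia.
have TL : T < 2 ^ L by rewrite /T; lia.
rewrite -/(stat_ _ _); have := stat_spec i.*2 (t, c, d).
case: (stat_ i.*2 _) => [[[z cnt] ok] nb] [zE _ _ _] /=.
rewrite /= odd_double /= (thr d).1 in zE *.
set d' := odflt _ _.
have := stat_spec i.*2.+1 (t, c, d').
rewrite -/(stat_ _ _); case: (stat_ _ _) => [[[z' cnt'] ok'] nb'] [_ cE okE _] /=.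
rewrite negbK odd_double (thr d').2 in cE okE *.
(* A free prefix has a code matching the sketch, so [pick] succeeds, and injectivity identifies
   every match with it. For other prefixes [d'] is arbitrary and left to the check. *)
have d'P : find_copy hE T G = None -> code_edges d' T = lower T G.
  move=> Tn; have [c' c'E] := find_copy_code em n0 oriented_stream Tn.
  rewrite /d'; case: pickP => [d2 /eqP e2|/(_ c')]; last first.
    by rewrite c'E -zE eqxx.
  rewrite -c'E; apply: r_inj; first exact: ltnW.
  by rewrite /collision e2 c'E zE.
have inT : (inord T : 'I_(2 ^ L).+1) = T :> nat by rewrite inordK // ltnS ltnW.
case: ifP => [/and3P[ok1 /eqP cnt1 /eqP f1]|fail].
  (* Containment in the candidate together with equal edge counts gives equality. *)
  have dT : code_edges d' T = lower T G.
    by apply/esym/eqP; rewrite eqEcard -okE ok1 -cE cnt1 leqnn.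
  split; rewrite /= ?inT -/P //.
  - by rewrite /T; lia.
  - by rewrite -find_copy_lower -dT.
  - by rewrite /T -addnA -P2.
split; rewrite /= -/P -/T //; first exact: ltnW.
right => Tn; move/negP: fail; apply; rewrite okE cE (d'P Tn) subxx eqxx /=.
by rewrite find_copy_lower Tn.
Qed.

Lemma answer_correct : correct_answer hE s
  (answer (memory_ L.*2) (stat_ L.*2 (memory_ L.*2))).
Proof.
have : search_inv L (memory_ L.*2).
  have: L <= L by []; elim: {-2}L => [_|i IH iL]; first exact: search_inv0.
  by apply: search_inv_step => //; apply: IH; apply: ltnW.
have := stat_spec L.*2 (memory_ L.*2).
case: (stat_ _ _) => [[[z cnt] ok] nb]; case: (memory_ _) => [[t c] d] [_ _ _ nbE].
rewrite /search_inv /= subnn addn1 => -[tL tn tc tmax].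
rewrite /answer /=.
have -> : code_edges c t :|: [set e : edge n | (e.1 \in nb) && (e.2 == t :> nat)]
    = lower t.+1 G.
  apply/setP => -[u v]; rewrite tc nbE !inE /= ltnS [v <= t]leq_eqVlt.
  have [vt|vt] /= := eqVneq (v : nat) t; last by rewrite andbF orbF.
  rewrite andbT -vt ltnn andbF /=; apply/exists_inP/idP => [[[a b]]|uv].
    by rewrite inE => ab /= /andP[/eqP <- /eqP e]; rewrite (val_inj e) in ab; rewrite ab.
  by exists (u, v); rewrite ?inE /= ?eqxx //; case/andP: uv.
rewrite find_copy_lower.
have eG u v : edge_rel G u v = gadj s u v by rewrite /edge_rel /gadj !inE.
case fc: (find_copy hE t.+1 G) => [V|] /=.
  have [f [fi fV fE]] := find_copy_some fc.
  by exists f; split=> // a b; rewrite fE eG.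
move=> [V [f [fi _ fE]]].
(* Without a copy below [t.+1], the upper end of the bracket is the sentinel [2 ^ L], which exceeds
   [n]; so the free prefix is the whole graph. *)
have nt : n <= t.
  by case: tmax => [e|/(_ fc)//]; rewrite -ltnS; apply: leq_trans nL _; rewrite -[X in X <= _]e.
apply: (find_copy_none tn fi) => [a|a b]; first exact: leq_trans (ltn_ord _) nt.
by rewrite fE eG.
Qed.
End Run.

Lemma search_alg S : #|{: option (memst * accu)}| <= 2 ^ S ->
  exists A : salg n L.*2.+1 S, det_solves hE A.
Proof.
move=> cS; have [A runA] := adaptive_alg mem0 accu0 accu_step mem_upd L.*2 answer cS.
by exists A => s vs; rewrite runA; apply: answer_correct.
Qed.
End Search.

Lemma p4_like_easy (h : nat) (hE : rel 'I_h) : 0 < h -> embeds_in_p4 hE ->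
  exists (q : nat -> nat) (c k N : nat),
    forall n, (N <= n)%N ->
      (q n <= c * (trunc_log 2 n).+1 ^ k)%N /\
      exists S, (S <= c * n * (trunc_log 2 n).+1 ^ k)%N /\
        exists A : salg n (q n) S, det_solves hE A.
Proof.
move=> h0 em.
exists (fun n => (trunc_log 2 n).+1.*2.+1), 30, 1, 1 => n n0.
set L := (trunc_log 2 n).+1; rewrite expn1; split; first by lia.
have nL : n < 2 ^ L by apply: trunc_log_ltn.
pose C := (2 * L + 1) * n.
have cC : #|{: code n}| <= 2 ^ C.
  rewrite card_tuple !card_prod card_ord card_bool /C expnM leq_exp2r //.
  by rewrite expnD expn1 leq_mul2r mul2n -addnn expnD leq_mul ?orbT // ltnW.
have cT : #|{: 'I_(2 ^ L).+1}| <= 2 ^ L.+1.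
  by rewrite card_ord expnS; have := expn_gt0 2 L; move: (2 ^ L) => u; lia.
(* There are at most [2 ^ (C + L.+1)] pairs of a code and a length; [sketch_exists] asks for more
   than the square of that. *)
pose m := (C + L.+1).*2.+1.
have [r rP] : exists r : {ffun edge n -> 'I_(2 ^ m)},
    forall i j : code n * 'I_(2 ^ L).+1,
    collision r (code_edges i.1 i.2) (code_edges j.1 j.2) ->
    code_edges i.1 i.2 = code_edges j.1 j.2.
  apply: sketch_exists; rewrite card_prod.
  apply: (@leq_ltn_trans (2 ^ (C + L.+1) * 2 ^ (C + L.+1))).
    by rewrite expnD; apply: leq_mul; apply: leq_mul.
  by rewrite -expnD addnn ltn_exp2l.
have m0 : 0 < 2 ^ m by rewrite expn_gt0.
(* Bits for the option, the prefix length, two codes, the sketch value, the edge count, the flag and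
   the neighbour set. *)
exists (1 + (L.+1 + C + C + (m + L.*2 + 1 + n))); split.
  rewrite /m /C /L; move: (trunc_log 2 n) => l; clear -n0; nia.
apply: (@search_alg h hE n L (2 ^ m) h0 em n0 nL m0 r).
  move=> c c' t tL; have tL' : t < (2 ^ L).+1 by rewrite ltnS.
  exact: (rP (c, Ordinal tL') (c', Ordinal tL')).
have cs : #|{set 'I_n}| = 2 ^ n by rewrite -cardsT -powersetT card_powerset cardsT card_ord.
rewrite card_option !card_prod card_bool cs (card_ord (2 ^ m)) (card_ord (n * n).+1).
have nn : (n * n).+1 <= 2 ^ L.*2.
  by rewrite -addnn expnD; move: nL; move: (2 ^ L) => u; nia.
have big : #|'I_(2 ^ L).+1| * #|{: code n}| * #|{: code n}| *
   (2 ^ m * (n * n).+1 * 2 * 2 ^ n) <= 2 ^ (L.+1 + C + C + (m + L.*2 + 1 + n)).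
  have E a b c d e : 2 ^ (a + b + b + (c + d + 1 + e)) =
      2 ^ a * 2 ^ b * 2 ^ b * (2 ^ c * 2 ^ d * 2 * 2 ^ e) by rewrite !expnD expn1.
  rewrite E; apply: leq_mul; first by do 2 apply: leq_mul => //.
  by do 3 apply: leq_mul => //.
rewrite expnD expn1 mul2n -addnn.
apply: leq_ltn_trans big _.
by rewrite -[X in X < _]addn0 ltn_add2l expn_gt0.
Qed.

(** * Set disjointness *)

Section Bias.
Variable T : finType.
Implicit Types (D B x : {set T}) (A : {set {set T}}).

(** The sum factors over points: a point of [B] contributes [1 + 2], a point of [D :\: B]
    contributes [1 + 1]. [F] and [G] are the weights of a point inside and outside [x]. *)
Lemma sum_subset_weight D B : B \subset D ->
  (\sum_(x : {set T} | x \subset D) 2 ^ #|B :\: x|) * 2 ^ #|B| = 2 ^ #|D| * 3 ^ #|B|.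
Proof.
move=> sBD.
pose F (i : T) := (i \in D : nat).
pose G (i : T) := if i \in B then 2 else 1.
have -> : \sum_(x : {set T} | x \subset D) 2 ^ #|B :\: x|
   = \sum_(J : {set T}) \prod_i (if i \in J then F i else G i).
  rewrite big_mkcond /=; apply: eq_bigr => x _.
  case: ifPn => [sxD|/subsetPn[i xi Di]]; last first.
    by rewrite (bigD1 i) //= xi /F (negbTE Di) mul0n.
  have -> : \prod_i (if i \in x then F i else G i) = \prod_(i in B :\: x) 2.
    rewrite [RHS]big_mkcond /=; apply: eq_bigr => i _; rewrite inE /F /G.
    by case: ifP => xi //=; rewrite (subsetP sxD _ xi).
  by rewrite prod_nat_const.
rewrite -bigA_distr.
have -> : \prod_i (F i + G i) = 2 ^ #|D :\: B| * 3 ^ #|B|.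
  rewrite (bigID (mem B)) /= mulnC; congr (_ * _).
    rewrite (bigID (mem D)) /= [X in _ * X]big1 ?muln1; last first.
      by move=> i /andP[/negbTE nB /negbTE nD]; rewrite /F /G nB nD.
    rewrite -prod_nat_const; apply: eq_big => i; first by rewrite !inE.
    by move=> /andP[/negbTE nB iD]; rewrite /F /G nB iD.
  rewrite -prod_nat_const; apply: eq_bigr => i iB.
  by rewrite /F /G iB (subsetP sBD _ iB).
have /esym := cardsID B D; rewrite (setIidPr sBD) addnC => ->.
by rewrite expnD; lia.
Qed.

(* Weighting each subset x of D by 2 ^ #|B :\: x|; the eighth power clears the
   fractional exponent, using 2 * 3^8 <= 2^14. *)
Lemma sparse_family_card A D B :
  (forall x, x \in A -> x \subset D) -> B \subset D ->
  (forall x, x \in A -> 4 * #|x :&: B| <= #|B|) ->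
  #|A| ^ 8 * 2 ^ #|B| <= 2 ^ (8 * #|D|).
Proof.
move=> sAD sBD sp; set b := #|B|; pose c := b - b %/ 4.
have c4 : 3 * b <= 4 * c by rewrite /c; lia.
have H1 : #|A| * 2 ^ c <= \sum_(x : {set T} | x \subset D) 2 ^ #|B :\: x|.
  rewrite -sum_nat_const [X in _ <= X](bigID (mem A)) /=.
  apply: leq_trans (leq_addr _ _).
  rewrite [X in _ <= X](eq_bigl (fun x => x \in A)); last first.
    by move=> x; rewrite /=; case: (boolP (x \in A)) => [xA|_]; rewrite ?andbF ?(sAD _ xA).
  apply: leq_sum => x xA; rewrite leq_exp2l //.
  have := sp _ xA; have := cardsID x B; rewrite setIC -/b /c; lia.
have {}H1 : #|A| * 2 ^ c * 2 ^ b <= 2 ^ #|D| * 3 ^ b.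
  by rewrite -(sum_subset_weight sBD) leq_mul2r H1 orbT.
have : (#|A| * 2 ^ c * 2 ^ b) ^ 8 <= (2 ^ #|D| * 3 ^ b) ^ 8 by rewrite leq_exp2r.
rewrite !expnMn -!expnM => H3.
have H4 : 2 ^ b * (3 ^ (b * 8)) <= 2 ^ (c * 8) * 2 ^ (b * 8).
  apply: (@leq_trans (2 ^ (6 * b) * 2 ^ (b * 8))); last first.
    by rewrite leq_mul2r leq_exp2l ?orbT //; lia.
  rewrite -expnD; have -> : 6 * b + b * 8 = 14 * b by lia.
  rewrite [b * 8]mulnC !expnM -expnMn.
  by case: (posnP b) => [->//|b0]; rewrite leq_exp2r.
have p3 : 0 < 3 ^ (b * 8) by rewrite expn_gt0.
rewrite -(leq_pmul2r p3) -mulnA.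
apply: leq_trans (leq_mul (leqnn _) H4) _.
by rewrite mulnA (mulnC 8).
Qed.

Definition light A D : {set T} :=
  [set i in D | 8 * #|[set x in A | i \in x]| < #|A|].

(** By double counting, members of [A] meet the light set [B] in at most [#|B| / 8] points on
    average; by Markov at least half of them meet it in at most [#|B| / 4], and these form a sparse
    family. The extra 8 in the exponent pays for that half. *)
Lemma card_light A D : (forall x, x \in A -> x \subset D) ->
  #|A| ^ 8 * 2 ^ #|light A D| <= 2 ^ (8 * #|D|.+1).
Proof.
move=> sAD; set B := light A D.
have sBD : B \subset D by apply/subsetP=> i; rewrite inE => /andP[].
pose L := [set x in A | 4 * #|x :&: B| <= #|B|].
have HL : #|L| ^ 8 * 2 ^ #|B| <= 2 ^ (8 * #|D|).
  apply: sparse_family_card => // x; rewrite inE => /andP[]; first by move/sAD.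
  by [].
have sum1 : \sum_(x in A) #|x :&: B| = \sum_(i in B) #|[set x in A | i \in x]|.
  transitivity (\sum_(x in A) \sum_(i in B) (i \in x)).
    apply: eq_bigr => x _; rewrite -sum1_card big_mkcond /= [RHS]big_mkcond /=.
    by apply: eq_bigr => i _; rewrite inE; do 2 case: (_ \in _).
  rewrite exchange_big /=; apply: eq_bigr => i _.
  rewrite -sum1_card big_mkcond /= [RHS]big_mkcond /=.
  by apply: eq_bigr => x _; rewrite inE; do 2 case: (_ \in _).
have le1 : 8 * (\sum_(x in A) #|x :&: B|) <= #|B| * #|A|.
  rewrite sum1 big_distrr /= -sum_nat_const.
  by apply: leq_sum => i; rewrite inE => /andP[_ /ltnW].
have half : #|A| <= 2 * #|L|.
  have [b0|b0] := posnP #|B|.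
    apply: leq_trans (leq_pmull _ _) => //; rewrite subset_leq_card //.
    apply/subsetP=> x xA; rewrite inE xA b0 /= leqn0 muln_eq0 /=.
    by rewrite -leqn0 -b0 subset_leq_card // subsetIr.
  have : #|B| * #|A :\: L| <= 4 * (\sum_(x in A) #|x :&: B|).
    rewrite mulnC -sum_nat_const big_distrr /= [X in _ <= X](big_setID L) /=.
    apply: leq_trans (leq_addl _ _).
    apply: leq_sum => x; rewrite !inE => /andP[/nandP[/negbTE -> //|]].
    by rewrite -ltnNge => /ltnW.
  have /esym := cardsID L A; have -> : A :&: L = L.
    by apply/setIidPr/subsetP => x; rewrite inE => /andP[].
  move=> eA H.
  have : 2 * (#|B| * #|A :\: L|) <= #|B| * #|A| by lia.
  by nia.
have : #|A| ^ 8 <= 2 ^ 8 * #|L| ^ 8 by rewrite -expnMn leq_exp2r.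
rewrite mulnS expnD; move: HL; nia.
Qed.
End Bias.

Section Corruption.
Variable T : finType.
Implicit Types (D x : {set T}) (P Q : pred {set T}).
Local Notation N := #|T|.

(* Razborov's rectangle bound. The hard distributions pick D at random; disjoint
   pairs have x inside D and y inside ~: D, while intersecting pairs additionally
   share one point i. *)
Definition fam P D : {set {set T}} := [set x | P x & x \subset D].
Definition cone P i D : nat := #|[set x in fam P (i |: D) | i \in x]|.

Lemma fam_sub P D x : x \in fam P D -> x \subset D.
Proof. by rewrite inE => /andP[]. Qed.

Lemma card_fam_le P D : #|fam P D| <= 2 ^ #|D|.
Proof.
rewrite -card_powerset subset_leq_card //; apply/subsetP => x.
by rewrite !inE => /andP[].
Qed.

(** Points avoided by fewer than an eighth of the family. Biased points are those on which a random
    member is nearly decided. *)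
Definition colight P D : {set T} := light [set D :\: x | x in fam P D] D.
Definition biased P D := light (fam P D) D :|: colight P D.

Lemma setDI_sub D x : x \subset D -> D :\: (D :\: x) = x.
Proof. by move=> sxD; rewrite setDDr setDv set0U; apply/setIidPr. Qed.

Lemma setD_fam_inj P D : {in fam P D &, injective (fun x => D :\: x)}.
Proof.
move=> x y /fam_sub sx /fam_sub sy /= e.
by rewrite -(setDI_sub sx) e setDI_sub.
Qed.

Lemma in_colight P D i : i \in D ->
  (i \in colight P D) = (8 * #|fam P (D :\ i)| < #|fam P D|).
Proof.
move=> iD; rewrite inE iD card_in_imset /=; last exact: setD_fam_inj.
congr (8 * _ < _).
rewrite -[RHS](card_in_imset (f := fun x => D :\: x)); last first.
  move=> x y; rewrite !inE => /andP[_ sx] /andP[_ sy] /= e.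
  have sD : forall z : {set T}, z \subset D :\ i -> z \subset D.
    by move=> z /subset_trans; apply; apply: subsetDl.
  by rewrite -(setDI_sub (sD _ sx)) e setDI_sub // sD.
congr #|pred_of_set _|; apply/setP => z; apply/idP/imsetP => [|[x]].
  rewrite !inE => /andP[/imsetP[x]]; rewrite inE => /andP[Px sx] -> .
  rewrite !inE iD andbT => ix; exists x => //.
  by rewrite inE Px subsetD1 sx ix.
rewrite [x \in fam _ _]inE subsetD1 => /and3P[Px sx ix] ->; rewrite !inE ix iD !andbT.
by apply/imsetP; exists x; rewrite // inE Px.
Qed.

Lemma card_biased K P D : 2 ^ #|D| <= 2 ^ K * #|fam P D| ->
  #|biased P D| <= 16 * K.+1.
Proof.
move=> big.
have gen (A : {set {set T}}) : (forall x, x \in A -> x \subset D) ->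
    #|A| = #|fam P D| -> #|light A D| <= 8 * K.+1.
  move=> sA eA; have := card_light sA; rewrite eA => H.
  have : (2 ^ #|D|) ^ 8 <= (2 ^ K * #|fam P D|) ^ 8 by rewrite leq_exp2r.
  rewrite expnMn -!expnM => H8.
  have : 2 ^ (#|D| * 8) * 2 ^ #|light A D| <= 2 ^ (K * 8) * 2 ^ (8 * #|D|.+1).
    apply: leq_trans (leq_mul H8 (leqnn _)) _.
    by rewrite -mulnA leq_mul2l H orbT.
  by rewrite -!expnD leq_exp2l //; lia.
apply: leq_trans (leq_card_setU _ _) _.
have -> : 16 * K.+1 = 8 * K.+1 + 8 * K.+1 by lia.
apply: leq_add; apply: gen => //; first exact: fam_sub.
  by move=> x /imsetP[y _ ->]; apply: subsetDl.
by rewrite card_in_imset //; apply: setD_fam_inj.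
Qed.

Lemma fam_mono P D D' : D \subset D' -> #|fam P D| <= #|fam P D'|.
Proof.
move=> sD; apply/subset_leq_card/subsetP => x; rewrite !inE => /andP[-> sx].
exact: subset_trans sx sD.
Qed.

(** One summand per case. If [i] is unbiased on both sides, each cone holds an eighth of its family,
    hence 64. If [i] is biased for [P], the second summand suffices. If it is biased only for [Q],
    the mass is charged to [D :\ i], at a loss of at most 8 because [i] is not colight for [P]. *)
Lemma pair_bound P Q D i : i \in D ->
  #|fam P D| * #|fam Q (~: D)| <=
  64 * (cone P i D * cone Q i (~: D))
  + (i \in biased P D) * (#|fam P D| * #|fam Q (~: D)|)
  + 8 * ((i \in biased Q (~: (D :\ i))) *
         (#|fam P (D :\ i)| * #|fam Q (~: (D :\ i))|)).
Proof.
move=> iD.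
have eDi : ~: (D :\ i) = i |: ~: D.
  by apply/setP => j; rewrite !inE negb_and negbK.
have iDi : i \in ~: (D :\ i) by rewrite !inE eqxx.
have coneQ : cone Q i (~: D) = #|[set x in fam Q (~: (D :\ i)) | i \in x]|.
  by rewrite /cone eDi.
have coneP : cone P i D = #|[set x in fam P D | i \in x]|.
  by rewrite /cone (setUidPr _) // sub1set.
have mono : #|fam Q (~: D)| <= #|fam Q (~: (D :\ i))|.
  by rewrite fam_mono // setCS subsetDl.
case: (boolP (i \in biased P D)) => [_|].
  by rewrite mul1n addnAC leq_addl.
rewrite in_setU in_colight // [i \in light _ _]inE iD -coneP /= negb_or -!leqNgt.
case/andP=> p1 p0.
case: (boolP (i \in biased Q _)) => [_|].
  rewrite mul0n addn0 mul1n; apply: leq_trans (leq_addl _ _).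
  by rewrite mulnA; apply: leq_mul.
rewrite in_setU [i \in light _ _]inE iDi -coneQ /= negb_or -!leqNgt.
case/andP=> q1 _; rewrite !mul0n muln0 !addn0.
by have := leq_mul p1 (leq_trans mono q1); rewrite mulnACA.
Qed.

(** [Z0] and [Z1] are the unnormalised masses of the rectangle under the disjoint and the
    intersecting hard distribution. *)
Definition Z0 P Q := \sum_(D : {set T}) #|fam P D| * #|fam Q (~: D)|.
Definition Z1 P Q := \sum_(i : T) \sum_(D : {set T}) cone P i D * cone Q i (~: D).

Lemma sum_memb (A : {set T}) m : \sum_i (i \in A) * m = #|A| * m.
Proof.
by rewrite -big_distrl /= -sum1_card [in RHS]big_mkcond /=.
Qed.

Lemma half_bound P Q :
  \sum_(D : {set T}) #|D| * (#|fam P D| * #|fam Q (~: D)|) <=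
  64 * (\sum_(i : T) \sum_(D : {set T} | i \in D) cone P i D * cone Q i (~: D))
  + \sum_(D : {set T}) #|biased P D| * (#|fam P D| * #|fam Q (~: D)|)
  + 8 * (\sum_(D : {set T}) #|biased Q (~: D)| * (#|fam P D| * #|fam Q (~: D)|)).
Proof.
pose w D := #|fam P D| * #|fam Q (~: D)|.
have -> : \sum_(D : {set T}) #|D| * (#|fam P D| * #|fam Q (~: D)|)
        = \sum_(i : T) \sum_(D : {set T} | i \in D) w D.
  under [LHS]eq_bigr => D _ do rewrite -/(w D) -sum_memb.
  rewrite exchange_big /=; apply: eq_bigr => i _; rewrite [RHS]big_mkcond /=.
  by apply: eq_bigr => D _; case: (i \in D); rewrite ?mul1n.
apply: (@leq_trans (\sum_(i : T) \sum_(D : {set T} | i \in D)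
  (64 * (cone P i D * cone Q i (~: D)) + (i \in biased P D) * w D
  + 8 * ((i \in biased Q (~: (D :\ i))) * w (D :\ i))))).
  by apply: leq_sum => i _; apply: leq_sum => D iD; apply: pair_bound.
under eq_bigr => i _ do rewrite big_split /= big_split /=.
rewrite big_split /= big_split /=; apply: leq_add; first apply: leq_add.
- by rewrite big_distrr /= leq_sum // => i _; rewrite big_distrr.
- under [X in _ <= X]eq_bigr => D _ do rewrite -/(w D) -sum_memb.
  rewrite [X in _ <= X]exchange_big /=; apply: leq_sum => i _.
  by rewrite big_mkcond leq_sum // => D _; case: ifP.
- rewrite big_distrr /=.
  under [X in _ <= X]eq_bigr => D _ do rewrite -/(w D) -sum_memb big_distrr /=.
  rewrite [X in _ <= X]exchange_big /=; apply: leq_sum => i _.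
  rewrite [X in _ <= X](bigID (fun D : {set T} => i \in D)) /=.
  apply: leq_trans (leq_addl _ _).
  rewrite [X in _ <= X](reindex_onto (fun D => D :\ i) (fun D => i |: D)) /=; last first.
    by move=> D iD; rewrite setU1K.
  rewrite big_mkcond [X in _ <= X]big_mkcond /=; apply: leq_sum => D _.
  by case: (boolP (i \in D)) => // iD; rewrite !inE eqxx /= setD1K // eqxx.
Qed.

(** Dense families have few biased points by [card_biased]; a family of density below [2 ^ - K]
    weighs so little that the trivial bound [#|T|] on its biased points costs only the error
    term. *)
Lemma sum_biased_bound K P (q : {set T} -> nat) :
  (forall D, q D <= 2 ^ #|~: D|) ->
  2 ^ K * (\sum_(D : {set T}) #|biased P D| * (#|fam P D| * q D)) <=
  16 * K.+1 * (2 ^ K * (\sum_(D : {set T}) #|fam P D| * q D)) + N * 4 ^ N.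
Proof.
move=> qle.
have -> : N * 4 ^ N = \sum_(D : {set T}) N * 2 ^ N.
  rewrite sum_nat_const -[#|{set T}|]cardsT -powersetT card_powerset cardsT.
  by rewrite -[4]/(2 * 2) expnMn; lia.
rewrite !big_distrr /= -big_split /=; apply: leq_sum => D _.
case: (leqP (2 ^ #|D|) (2 ^ K * #|fam P D|)) => [/card_biased H|/ltnW H].
  by apply: leq_trans (leq_addr _ _); nia.
apply: leq_trans (leq_addl _ _).
have -> : 2 ^ N = 2 ^ #|D| * 2 ^ #|~: D| by rewrite -expnD cardsC.
rewrite mulnCA (mulnA (2 ^ K)) (mulnA #|biased P D|) (mulnA N).
exact: leq_mul (leq_mul (max_card _) H) (qle D).
Qed.

(** [half_bound] covers the points of [D]; exchanging [P] with [Q] and complementing [D] covers the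
    rest. Each of the two biased sums then occurs [1 + 8] times, which gives 18 error terms and
    [288 = 18 * 16]. *)
Lemma corruption K P Q :
  2 ^ K * N * Z0 P Q <=
  64 * (2 ^ K * Z1 P Q) + 288 * K.+1 * (2 ^ K * Z0 P Q) + 18 * (N * 4 ^ N).
Proof.
have h1 := half_bound P Q; have h2 := half_bound Q P.
have fle P' D : #|fam P' (~: D)| <= 2 ^ #|~: D| by exact: card_fam_le.
have reC (F : {set T} -> nat) : \sum_(D : {set T}) F (~: D) = \sum_(D : {set T}) F D.
  by rewrite [RHS](reindex_inj (inv_inj (@setCK T))).
have b1 := sum_biased_bound K P (fle Q).
have b2 := sum_biased_bound K Q (fle P).
have ec : Z0 P Q = \sum_(D : {set T}) #|fam Q D| * #|fam P (~: D)|.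
  rewrite /Z0 -reC; apply: eq_bigr => D _; rewrite setCK; lia.
have e2 : \sum_(D : {set T}) #|biased Q (~: D)| * (#|fam P D| * #|fam Q (~: D)|)
   = \sum_(D : {set T}) #|biased Q D| * (#|fam Q D| * #|fam P (~: D)|).
  by rewrite -reC; apply: eq_bigr => D _; rewrite setCK; lia.
have e1 : \sum_(D : {set T}) #|biased P (~: D)| * (#|fam Q D| * #|fam P (~: D)|)
   = \sum_(D : {set T}) #|biased P D| * (#|fam P D| * #|fam Q (~: D)|).
  by rewrite -reC; apply: eq_bigr => D _; rewrite setCK; lia.
have eN : N * Z0 P Q = \sum_(D : {set T}) #|D| * (#|fam P D| * #|fam Q (~: D)|)
    + \sum_(D : {set T}) #|D| * (#|fam Q D| * #|fam P (~: D)|).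
  rewrite -[X in _ + X]reC -big_split /= /Z0 big_distrr /=.
  by apply: eq_bigr => D _; rewrite setCK -(cardsC D); lia.
have eZ1 : Z1 P Q = \sum_(i : T) \sum_(D : {set T} | i \in D) cone P i D * cone Q i (~: D)
    + \sum_(i : T) \sum_(D : {set T} | i \in D) cone Q i D * cone P i (~: D).
  rewrite -big_split /=; apply: eq_bigr => i _.
  rewrite (bigID (fun D : {set T} => i \in D)) /=; congr (_ + _).
  rewrite (reindex_inj (inv_inj (@setCK T))) /=; apply: eq_big => D.
    by rewrite inE negbK.
  by rewrite setCK mulnC.
rewrite -mulnA eN eZ1; rewrite -ec in b2; rewrite -/(Z0 P Q) in b1.
move: h1 h2; rewrite e1 e2 => h1 h2; clear eN eZ1 e1 e2 ec reC.
move: h1 h2 b1 b2; move: (\sum_(D : {set T}) _) => S1; move: (\sum_(D : {set T}) _) => S2.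
move: (\sum_(D : {set T}) _) => S3; move: (\sum_(D : {set T}) _) => S4.
nia.
Qed.
End Corruption.

(** * Sums of combinatorial rectangles *)

Section Rect.
Variables X Y : Type.
Implicit Types g : X -> Y -> nat.

(** Sums with multiplicity instead of partitions: the class is closed under sums and products, hence
    contains acceptance counts over seeds and their powers. *)
Definition rect (B : nat) g : Prop :=
  exists L : seq (pred X * pred Y), size L <= B /\
    forall x y, g x y = \sum_(w <- L) w.1 x * w.2 y.

Lemma eq_rect B g g' : (forall x y, g x y = g' x y) -> rect B g -> rect B g'.
Proof. by move=> e [L [sL eL]]; exists L; split=> // x y; rewrite -e eL. Qed.

Lemma rect1 (P : pred X) (Q : pred Y) : rect 1 (fun x y => P x * Q y).
Proof. by exists [:: (P, Q)]; split=> // x y; rewrite big_seq1. Qed.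

Lemma rect_mul B1 B2 g1 g2 :
  rect B1 g1 -> rect B2 g2 -> rect (B1 * B2) (fun x y => g1 x y * g2 x y).
Proof.
move=> [L1 [s1 e1]] [L2 [s2 e2]].
pose h (u v : pred X * pred Y) : pred X * pred Y :=
  (fun x => u.1 x && v.1 x, fun y => u.2 y && v.2 y).
exists [seq h u v | u <- L1, v <- L2]; split.
  by rewrite size_allpairs leq_mul.
move=> x y; rewrite e1 e2 big_allpairs_dep big_distrl /=; apply: eq_bigr => u _.
rewrite big_distrr /=; apply: eq_bigr => v _.
by case: (u.1 x) (u.2 y) (v.1 x) (v.2 y) => [] [] [] [].
Qed.

Lemma rect_exp B g t : rect B g -> rect (B ^ t) (fun x y => g x y ^ t).
Proof.
move=> rg; elim: t => [|t IH].
  by apply: eq_rect (rect1 predT predT) => x y.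
by rewrite expnS; apply: eq_rect (rect_mul rg IH) => x y; rewrite expnS.
Qed.

Lemma rect_sum_seq (I : Type) (s : seq I) B (F : I -> X -> Y -> nat) :
  (forall i, rect B (F i)) -> rect (size s * B) (fun x y => \sum_(i <- s) F i x y).
Proof.
move=> rF; elim: s => [|i s [L [sL eL]]].
  by exists [::]; split=> // x y; rewrite !big_nil.
have [L' [sL' eL']] := rF i; exists (L' ++ L); split.
  by rewrite size_cat mulSn leq_add.
by move=> x y; rewrite big_cons big_cat /= -eL -eL'.
Qed.

Lemma rect_sum (I : finType) B (F : I -> X -> Y -> nat) :
  (forall i, rect B (F i)) -> rect (#|I| * B) (fun x y => \sum_i F i x y).
Proof.
move=> rF; rewrite cardE; apply: eq_rect (rect_sum_seq (enum I) rF) => x y.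
by rewrite big_enum.
Qed.

End Rect.

Section Disj.
Variable T : finType.
Local Notation N := #|T|.
Implicit Types (g : {set T} -> {set T} -> nat) (P Q : pred {set T}).

Definition disj_sum g := \sum_(D : {set T})
  \sum_(x : {set T} | x \subset D) \sum_(y : {set T} | y \subset ~: D) g x y.
Definition meet_sum g := \sum_(i : T) \sum_(D : {set T})
  \sum_(x : {set T} | (x \subset i |: D) && (i \in x))
  \sum_(y : {set T} | (y \subset i |: ~: D) && (i \in y)) g x y.

Lemma sum_bool_card (A : {set {set T}}) (R P : pred {set T}) :
  (forall x, (x \in A) = P x && R x) -> \sum_(x : {set T} | R x) (P x : nat) = #|A|.
Proof.
move=> e; rewrite -sum1_card big_mkcond [RHS]big_mkcond /=.
by apply: eq_bigr => x _; rewrite e; case: (P x); case: (R x).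
Qed.

Lemma disj_sum_rect P Q : disj_sum (fun x y => P x * Q y) = Z0 P Q.
Proof.
apply: eq_bigr => D _; under eq_bigr => x _ do rewrite -big_distrr /=.
rewrite -big_distrl /=; congr (_ * _); apply: sum_bool_card => x; by rewrite inE.
Qed.

Lemma meet_sum_rect P Q : meet_sum (fun x y => P x * Q y) = Z1 P Q.
Proof.
apply: eq_bigr => i _; apply: eq_bigr => D _.
under eq_bigr => x _ do rewrite -big_distrr /=.
by rewrite -big_distrl /=; congr (_ * _); apply: sum_bool_card => x; rewrite !inE andbA.
Qed.

Lemma disj_sum_sum (I : Type) (s : seq I) (F : I -> {set T} -> {set T} -> nat) :
  disj_sum (fun x y => \sum_(w <- s) F w x y) = \sum_(w <- s) disj_sum (F w).
Proof.
rewrite /disj_sum [RHS]exchange_big /=; apply: eq_bigr => D _.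
rewrite [RHS]exchange_big /=; apply: eq_bigr => x _; by rewrite [RHS]exchange_big.
Qed.

Lemma meet_sum_sum (I : Type) (s : seq I) (F : I -> {set T} -> {set T} -> nat) :
  meet_sum (fun x y => \sum_(w <- s) F w x y) = \sum_(w <- s) meet_sum (F w).
Proof.
rewrite /meet_sum [RHS]exchange_big /=; apply: eq_bigr => i _.
rewrite [RHS]exchange_big /=; apply: eq_bigr => D _.
rewrite [RHS]exchange_big /=; apply: eq_bigr => x _; by rewrite [RHS]exchange_big.
Qed.

Lemma corruption_rect K B g : rect B g ->
  2 ^ K * N * disj_sum g <=
  64 * (2 ^ K * meet_sum g) + 288 * K.+1 * (2 ^ K * disj_sum g) + B * (18 * (N * 4 ^ N)).
Proof.
move=> [L [sL eL]].
have e0 : disj_sum g = \sum_(w <- L) Z0 w.1 w.2.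
  transitivity (disj_sum (fun x y => \sum_(w <- L) w.1 x * w.2 y)).
    by do 3 (apply: eq_bigr => ? _).
  by rewrite disj_sum_sum; apply: eq_bigr => w _; rewrite disj_sum_rect.
have e1 : meet_sum g = \sum_(w <- L) Z1 w.1 w.2.
  transitivity (meet_sum (fun x y => \sum_(w <- L) w.1 x * w.2 y)).
    by do 4 (apply: eq_bigr => ? _).
  by rewrite meet_sum_sum; apply: eq_bigr => w _; rewrite meet_sum_rect.
apply: (@leq_trans (64 * (2 ^ K * meet_sum g) + 288 * K.+1 * (2 ^ K * disj_sum g)
  + size L * (18 * (N * 4 ^ N)))); last first.
  by rewrite leq_add2l leq_mul2r sL orbT.
have -> : size L * (18 * (N * 4 ^ N)) = \sum_(w <- L) 18 * (N * 4 ^ N).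
  by rewrite big_const_seq count_predT iter_addn_0 mulnC.
rewrite e0 e1 !big_distrr /= -!big_split /=.
by apply: leq_sum => w _; apply: corruption.
Qed.

Lemma disj_sum_ge g c : (forall x y : {set T}, [disjoint x & y] -> c <= g x y) ->
  4 ^ N * c <= disj_sum g.
Proof.
move=> gc.
have -> : 4 ^ N * c = \sum_(D : {set T}) 2 ^ #|D| * (2 ^ #|~: D| * c).
  under eq_bigr => D _ do rewrite mulnA -expnD cardsC.
  rewrite sum_nat_const -[#|{set T}|]cardsT -powersetT card_powerset cardsT.
  by rewrite -[4]/(2 * 2) expnMn mulnA.
apply: leq_sum => D _; rewrite -!card_powerset -!sum_nat_const.
under [X in _ <= X]eq_bigl => x do rewrite -powersetE.
apply: leq_sum => x; rewrite powersetE => sx.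
under [X in _ <= X]eq_bigl => y do rewrite -powersetE.
apply: leq_sum => y; rewrite powersetE => sy; apply: gc.
rewrite disjoints_subset; apply: subset_trans sx _.
by rewrite -(setCK D) setCS.
Qed.

Lemma card_pointed_le (i : T) D :
  #|[set x : {set T} | (x \subset i |: D) && (i \in x)]| <= 2 ^ #|D|.
Proof.
rewrite -card_powerset -(card_in_imset (f := fun x => x :\ i)).
  apply/subset_leq_card/subsetP => z /imsetP[x]; rewrite !inE => /andP[sx _] ->.
  by apply/subsetP => j; rewrite !inE => /andP[/negbTE ji /(subsetP sx)]; rewrite !inE ji.
move=> x y; rewrite !inE => /andP[_ ix] /andP[_ iy] e.
by rewrite -(setD1K ix) e setD1K.
Qed.

Lemma meet_sum_le g c : (forall x y : {set T}, ~~ [disjoint x & y] -> g x y <= c) ->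
  meet_sum g <= N * 4 ^ N * c.
Proof.
move=> gc.
have -> : N * 4 ^ N * c = \sum_(i : T) \sum_(D : {set T}) 2 ^ #|D| * (2 ^ #|~: D| * c).
  rewrite sum_nat_const -mulnA; congr (_ * _).
  under eq_bigr => D _ do rewrite mulnA -expnD cardsC.
  rewrite sum_nat_const -[#|{set T}|]cardsT -powersetT card_powerset cardsT.
  by rewrite -[4]/(2 * 2) expnMn mulnA.
apply: leq_sum => i _; apply: leq_sum => D _.
apply: leq_trans (leq_mul (card_pointed_le i D) (leqnn _)).
rewrite -sum_nat_const; under [X in _ <= X]eq_bigl => x do rewrite inE.
apply: leq_sum => x /andP[_ ix].
apply: leq_trans (leq_mul (card_pointed_le i (~: D)) (leqnn _)).
rewrite -sum_nat_const; under [X in _ <= X]eq_bigl => y do rewrite inE.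
apply: leq_sum => y /andP[_ iy]; apply: gc.
by apply/pred0Pn; exists i; rewrite /= ix iy.
Qed.

(** As [576 = 2 * 288], the bias term is absorbed by half of the left side, and 64 doubles to
    [2 ^ 7]. The acceptance ratio 2 between disjoint and intersecting inputs must beat this, which
    its eighth power [2 ^ 8] does. The bound [2 ^ 13] covers [3 ^ 8]. *)
Lemma amplified_arith (p2 N F M8 Q8 W0 W1 c2 c3 k : nat) :
  0 < N * F * M8 -> c3 <= 2 ^ 13 -> c2 = 2 ^ 8 ->
  F * (c2 * M8) <= c3 * W0 -> c3 * W1 <= N * F * M8 ->
  576 * k <= N ->
  p2 * N * W0 <= 64 * (p2 * W1) + 288 * k * (p2 * W0) + M8 * Q8 * (18 * (N * F)) ->
  p2 <= 2 ^ 12 * Q8.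
Proof.
move=> U0 c3le ec2 h0 h1 kN cor.
pose U := N * F * M8.
have c1 : p2 * N * W0 <= 128 * (p2 * W1) + 36 * (U * Q8).
  clear - cor kN; have := leq_mul kN (leqnn (p2 * W0)); rewrite /U; lia.
have h2 : p2 * U * c2 <= c3 * (p2 * N * W0).
  clear - h0; have := leq_mul (leqnn (p2 * N)) h0; rewrite /U; lia.
have h3 : c3 * (p2 * W1) <= p2 * U.
  clear - h1; have := leq_mul (leqnn p2) h1; rewrite /U; lia.
have h4 : U * p2 * c2 <= U * p2 * 2 ^ 7 + U * (c3 * (36 * Q8)).
  move: (leq_mul (leqnn c3) c1) h2 (leq_mul (leqnn (2 ^ 7)) h3); rewrite -[128]/(2 ^ 7); clear.
  move: (2 ^ 7) => c1'; lia.
have e8 : c2 = 2 ^ 7 + 2 ^ 7 by rewrite ec2.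
have h5 : U * p2 * 2 ^ 7 <= U * (c3 * (36 * Q8)).
  by move: h4; rewrite e8 mulnDr leq_add2l.
rewrite -mulnA leq_pmul2l // in h5.
have h6 : c3 * (36 * Q8) <= 2 ^ 13 * (2 ^ 6 * Q8).
  by rewrite leq_mul // leq_mul2r orbT.
have := leq_trans h5 h6; rewrite mulnC (mulnA (2 ^ 13)) -expnD.
have -> : 2 ^ (13 + 6) = 2 ^ 7 * 2 ^ 12 by rewrite -expnD.
by rewrite -mulnA leq_pmul2l.
Qed.

(* Raising the acceptance count z to the power 8 replaces success amplification:
   z ^ 8 counts the 8-tuples of seeds that all accept, and it is still a sum of
   rectangles. *)
Lemma disjointness_bound (z : {set T} -> {set T} -> nat) (M Q K : nat) :
  0 < M -> rect (M * Q) z ->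
  (forall x y : {set T}, [disjoint x & y] -> 2 * M <= 3 * z x y) ->
  (forall x y : {set T}, ~~ [disjoint x & y] -> 3 * z x y <= M) ->
  576 * K.+1 <= N -> 2 ^ K <= 2 ^ 12 * Q ^ 8.
Proof.
move=> M0 /(rect_exp 8) /(corruption_rect K) cor zd zm KN.
set W0 := disj_sum _ in cor; set W1 := meet_sum _ in cor.
have h0 : 4 ^ N * (2 * M) ^ 8 <= 3 ^ 8 * W0.
  apply: leq_trans (disj_sum_ge (g := fun x y => (3 * z x y) ^ 8) _) _.
    by move=> x y d; rewrite leq_exp2r // zd.
  rewrite /W0 /disj_sum big_distrr /=; apply: leq_sum => D _.
  rewrite big_distrr /=; apply: leq_sum => x _.
  by rewrite big_distrr /=; apply: leq_sum => y _; rewrite expnMn.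
have h1 : 3 ^ 8 * W1 <= N * 4 ^ N * M ^ 8.
  apply: leq_trans (meet_sum_le (g := fun x y => (3 * z x y) ^ 8) _); last first.
    by move=> x y d; rewrite leq_exp2r // zm.
  rewrite /W1 /meet_sum big_distrr /=; apply: leq_sum => i _.
  rewrite big_distrr /=; apply: leq_sum => D _.
  rewrite big_distrr /=; apply: leq_sum => x _.
  by rewrite big_distrr /=; apply: leq_sum => y _; rewrite expnMn.
have N0 : 0 < N by apply: leq_trans KN; rewrite muln_gt0.
rewrite expnMn in h0; rewrite !expnMn in cor.
apply: (amplified_arith _ _ _ h0 h1 KN cor) => //.
by rewrite !muln_gt0 N0 !expn_gt0 M0.
Qed.
End Disj.

(** * From disjointness to streams *)

Lemma pass_from_cat (E St : Type) (f : nat -> E -> St -> St) t s1 s2 st :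
  pass_from f t (s1 ++ s2) st = pass_from f (t + size s1) s2 (pass_from f t s1 st).
Proof.
elim: s1 t st => [|e s1 IH] t st /=; first by rewrite addn0.
by rewrite IH addSnnS.
Qed.

Section Transcripts.
Variables (n p S : nat) (X Y : Type).
Variables (sA : X -> seq (edge n)) (sB : Y -> seq (edge n)).
Variable A : salg n p S.
Local Notation St := (S.-tuple bool).

(** Once the memory states in the middle and at the end of every pass are fixed, the conditions on
    [x] and on [y] separate; each input realises exactly one such transcript. *)
Lemma rect_passes l (ks : seq 'I_p) (st st' : St) :
  rect ((#|{:St}| * #|{:St}|) ^ size ks)
    (fun x y => (foldl (fun st k => pass_from (s_step A k) l (sB y)
                          (pass_from (s_step A k) 0 (sA x) st)) st ks == st' : nat)).
Proof.
elim: ks st => [|k ks IH] st /=.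
  by apply: eq_rect (rect1 (fun _ => st == st') predT) => x y; rewrite muln1.
rewrite expnS -mulnA.
pose g mid e x y : nat := ((pass_from (s_step A k) 0 (sA x) st == mid)
  * (pass_from (s_step A k) l (sB y) mid == e))
  * (foldl (fun st k => pass_from (s_step A k) l (sB y)
       (pass_from (s_step A k) 0 (sA x) st)) e ks == st').
apply: (@eq_rect _ _ _ (fun x y => \sum_mid \sum_e g mid e x y)) => [x y|].
  rewrite (bigD1 (pass_from (s_step A k) 0 (sA x) st)) //= [X in _ + X]big1 ?addn0.
    rewrite (bigD1 (pass_from (s_step A k) l (sB y) (pass_from (s_step A k) 0 (sA x) st))) //=.
    rewrite [X in _ + X]big1 ?addn0.
      by rewrite /g !eqxx !mul1n.
    by move=> e; rewrite eq_sym /g => /negbTE ->; rewrite muln0 mul0n.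
  move=> mid; rewrite eq_sym => /negbTE ne; rewrite big1 // => e _.
  by rewrite /g ne !mul0n.
apply: rect_sum => mid; apply: rect_sum => e; rewrite -[X in rect X]mul1n.
apply: rect_mul; last exact: IH.
exact: (rect1 (fun x => pass_from (s_step A k) 0 (sA x) st == mid)
              (fun y => pass_from (s_step A k) l (sB y) mid == e)).
Qed.

(** Steps may depend on the stream position, so the second player must know the length of the first
    part; summing over it costs [L.+1], and the final state costs one more [2 ^ S]. *)
Lemma rect_run L (o : option {set 'I_n}) : (forall x, size (sA x) <= L) ->
  rect (L.+1 * (2 ^ S * (2 ^ S * 2 ^ S) ^ p))
    (fun x y => (run A (sA x ++ sB y) == o : nat)).
Proof.
move=> sL.
have cSt : 2 ^ S = #|{:St}| by rewrite card_tuple card_bool.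
rewrite cSt -{1}[L.+1]card_ord.
have -> : (#|{:St}| * #|{:St}|) ^ p = (#|{:St}| * #|{:St}|) ^ size (enum 'I_p).
  by rewrite size_enum_ord.
pose F l x y st := foldl (fun st k => pass_from (s_step A k) l (sB y)
                          (pass_from (s_step A k) 0 (sA x) st)) st (enum 'I_p).
apply: (@eq_rect _ _ _ (fun x y => \sum_(l < L.+1) \sum_st'
   ((size (sA x) == l) * (s_out A st' == o)) * (F l x y (s_init A) == st'))).
  move=> x y; have lx : size (sA x) < L.+1 by rewrite ltnS.
  rewrite (bigD1 (Ordinal lx)) //= [X in _ + X]big1 ?addn0; last first.
    move=> l nl; rewrite big1 // => st' _.
    have /negbTE -> : size (sA x) != l.
      by apply: contraNneq nl => e; apply/eqP/val_inj.
    by rewrite !mul0n.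
  have -> : run A (sA x ++ sB y) = s_out A (F (size (sA x)) x y (s_init A)).
    rewrite /run /F; congr (s_out A _).
    by elim: (enum _) (s_init A) => //= k ks IH st; rewrite pass_from_cat IH.
  rewrite (bigD1 (F (size (sA x)) x y (s_init A))) //= [X in _ + X]big1 ?addn0.
    by rewrite !eqxx mul1n muln1.
  by move=> st'; rewrite eq_sym => /negbTE ->; rewrite muln0.
apply: rect_sum => l; apply: rect_sum => st'; rewrite -[X in rect X]mul1n.
apply: rect_mul; last exact: rect_passes.
apply: eq_rect (rect1 (fun x => (size (sA x) == l) && (s_out A st' == o)) predT) => x y.
by rewrite muln1 mulnb.
Qed.
End Transcripts.

(** Only the answer [None] is counted: good seeds all give it on disjoint inputs and never on
    intersecting ones. *)
Lemma stream_bound (h : nat) (hE : rel 'I_h) (n p S : nat) (T : finType)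
    (sA sB : {set T} -> seq (edge n)) (K : nat) :
  (forall x y, valid_stream (sA x ++ sB y)) ->
  (forall x y : {set T}, [disjoint x & y] -> ~ exists V, induced_copy hE (sA x ++ sB y) V) ->
  (forall x y : {set T}, ~~ [disjoint x & y] -> exists V, induced_copy hE (sA x ++ sB y) V) ->
  rand_solves hE n p S -> 576 * K.+1 <= #|T| ->
  2 ^ K <= 2 ^ 12 * ((n * n).+1 * (2 ^ S * (2 ^ S * 2 ^ S) ^ p)) ^ 8.
Proof.
move=> val dis meet [m [A sol]].
pose z x y := \sum_(r : 'I_m.+1) (run (A r) (sA x ++ sB y) == None).
have sz x : size (sA x) <= n * n.
  have /andP[] := val x set0; rewrite cat_uniq => /and3P[u _ _] _.
  have := max_card (mem (sA x)); rewrite card_prod card_ord.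
  by rewrite (card_uniqP u).
have rz : rect (m.+1 * ((n * n).+1 * (2 ^ S * (2 ^ S * 2 ^ S) ^ p))) z.
  by rewrite -{1}[m.+1]card_ord; apply: rect_sum => r; apply: rect_run.
have zE x y : z x y = #|[set r | run (A r) (sA x ++ sB y) == None]|.
  rewrite -sum1_card [RHS]big_mkcond /=; apply: eq_bigr => r _.
  by rewrite inE; case: eqP.
apply: (disjointness_bound _ rz) => // x y d; have [good [g1 g2]] := sol _ (val x y).
  apply: leq_trans g1 _; rewrite leq_mul2l zE /=; apply/subset_leq_card/subsetP => r.
  move/g2; rewrite inE; case: (run _ _) => //= V iV.
  by case: (dis _ _ d); exists V.
have : #|good| + z x y <= m.+1.
  rewrite zE -[X in _ <= X]card_ord.
  apply: leq_trans (max_card (mem (good :|: [set r | run (A r) (sA x ++ sB y) == None]))).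
  rewrite cardsU (_ : _ :&: _ = set0) ?cards0 ?subn0 //.
  apply/setP => r; rewrite !inE; apply/negP => /andP[/g2] + /eqP rn.
  by rewrite rn /= => /(_ (meet _ _ d)).
by clear -g1; lia.
Qed.

(* A gadget blows H up: tag a of kind None is a single vertex (a, 0), tags of kind
   Some true / Some false get one clone per row / column index. The pairs in o
   are controlled by the first player through x, the others by the second through y. *)
Definition bitmap := nat -> nat -> bool.

Definition clone_idx (k : option bool) (i j : nat) : nat :=
  if k is Some b then (if b then i else j) else 0.

Definition owned (V Z : Type) (o : rel V) (EE : Z -> rel V) (x y : Z) : rel V :=
  fun u v => if o u v then EE x u v else EE y u v.

Definition gadget (h : nat) (hE : rel 'I_h) : Prop :=
  exists (kind : 'I_h -> option bool) (o : rel ('I_h * nat))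
         (EE : bitmap -> rel ('I_h * nat)),
  [/\ exists a, kind a != None,
      symmetric o, (forall x, symmetric (EE x)),
      forall (x y : bitmap) i j, x i j -> y i j ->
        forall a b, a != b ->
          hE a b = owned o EE x y (a, clone_idx (kind a) i j) (b, clone_idx (kind b) i j)
    & forall (x y : bitmap), (forall i j, ~~ (x i j && y i j)) ->
        forall f : 'I_h -> 'I_h * nat, injective f ->
          (forall a, (kind (f a).1 == None) ==> ((f a).2 == 0)) ->
          ~ (forall a b, a != b -> hE a b = owned o EE x y (f a) (f b))].

Section GadgetBound.
Variables (h' : nat).
Local Notation h := h'.+1.
Variables (hE : rel 'I_h) (hirr : irreflexive hE).
Variables (kind : 'I_h -> option bool) (o : rel ('I_h * nat)).
Variable EE : bitmap -> rel ('I_h * nat).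
Variable a0 : 'I_h.
Variables n m : nat.
Hypothesis a0k : kind a0 != None.
Hypothesis osym : symmetric o.
Hypothesis Esym : forall x, symmetric (EE x).
Hypothesis hm : m * h <= n.
Hypothesis m0 : 0 < m.

(* Vertices left over after m full blocks become clones of a0 with index >= m, on
   which both bitmaps vanish; hence every n is handled, not only multiples of h. *)
Definition place (v : nat) : 'I_h * nat :=
  let a := inord (v %% h) in
  if (if kind a == None then v %/ h == 0 else v %/ h < m) then (a, v %/ h)
  else (a0, m + v).

Lemma place_inj : injective place.
Proof.
have P v : place v = (inord (v %% h), v %/ h) \/ place v = (a0, m + v) /\
   ~~ (if kind (inord (v %% h)) == None then v %/ h == 0 else v %/ h < m).
  by rewrite /place; case: ifP => _; [left | right].
have Q v a q : place v = (a, q) -> q < m ->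
    a = inord (v %% h) /\ q = v %/ h.
  by case: (P v) => [-> [-> ->]|[-> _] [_ <-]] //; rewrite ltnNge leq_addr.
have R v a q : place v = (a, q) -> m <= q -> q = m + v.
  rewrite /place; case: ifP => [+ [_ <-]|_ [_ <-] //].
  by case: ifP => [_ /eqP ->|_]; [rewrite leqNgt m0 | rewrite ltnNge => /negbTE ->].
move=> u v; case e: (place v) => [a q] e'.
case: (ltnP q m) => qm.
  have [a1 q1] := Q _ _ _ e qm; have [a2 q2] := Q _ _ _ e' qm.
  rewrite (divn_eq u h) (divn_eq v h) -q1 -q2; congr (_ + _).
  have /(congr1 val) : inord (u %% h) = inord (v %% h) :> 'I_h by rewrite -a1 -a2.
  by rewrite /= !inordK // ltn_pmod.
by have := R _ _ _ e qm; rewrite (R _ _ _ e' qm) => /addnI.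
Qed.

Lemma place_kind v : (kind (place v).1 == None) ==> ((place v).2 == 0).
Proof.
rewrite /place; case: ifP => /=; last by rewrite (negbTE a0k).
by case: ifP.
Qed.

Lemma place_onto a q : (if kind a == None then q == 0 else q < m) ->
  exists2 v : 'I_n, true & place v = (a, q).
Proof.
move=> H; have qm : q < m by move: H; case: ifP => // _ /eqP ->.
have lt : q * h + a < n.
  apply: leq_trans hm; apply: (@leq_trans (q.+1 * h)); last by rewrite leq_mul2r qm.
  by rewrite mulSn addnC -addSn leq_add2r.
exists (Ordinal lt) => //=; rewrite /place.
have -> : (q * h + a) %% h = a by rewrite modnMDl modn_small.
have -> : (q * h + a) %/ h = q by rewrite divnMDl // divn_small // addn0.
by rewrite inord_val H.
Qed.

Local Notation T := ('I_m * 'I_m)%type.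
Definition bits (x : {set T}) : bitmap :=
  fun i j => [exists t in x, (val t.1 == i) && (val t.2 == j)].

Lemma bitsE x (t : T) : bits x t.1 t.2 = (t \in x).
Proof.
apply/existsP/idP => [[[u v]] /and3P[ux /= /eqP e1 /eqP e2]|tx].
  by case: t e1 e2 => a b /= /val_inj <- /val_inj <-.
by exists t; rewrite tx !eqxx.
Qed.

Lemma bits_lt x i j : bits x i j -> (i < m) && (j < m).
Proof. by case/existsP => -[a b] /and3P[_ /= /eqP <- /eqP <-]; rewrite !ltn_ord. Qed.

Definition streamA (x : {set T}) : seq (edge n) :=
  [seq e : edge n <- enum {: 'I_n * 'I_n} | [&& e.1 < e.2, o (place e.1) (place e.2)
     & EE (bits x) (place e.1) (place e.2)]].
Definition streamB (y : {set T}) : seq (edge n) :=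
  [seq e : edge n <- enum {: 'I_n * 'I_n} | [&& e.1 < e.2, ~~ o (place e.1) (place e.2)
     & EE (bits y) (place e.1) (place e.2)]].

Lemma mem_streamA x e : (e \in streamA x) = [&& e.1 < e.2,
  o (place e.1) (place e.2) & EE (bits x) (place e.1) (place e.2)].
Proof. by rewrite mem_filter mem_enum andbT. Qed.

Lemma mem_streamB y e : (e \in streamB y) = [&& e.1 < e.2,
  ~~ o (place e.1) (place e.2) & EE (bits y) (place e.1) (place e.2)].
Proof. by rewrite mem_filter mem_enum andbT. Qed.

Lemma valid_streamAB x y : valid_stream (streamA x ++ streamB y).
Proof.
have ue : uniq (enum {: 'I_n * 'I_n}) by exact: enum_uniq.
rewrite /valid_stream cat_uniq !(filter_uniq _ ue) andbT /=.
apply/andP; split.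
  apply/hasPn => e; rewrite mem_streamB => /and3P[_ /negbTE no _].
  by rewrite /= mem_streamA no andbF.
by apply/allP => e; rewrite mem_cat mem_streamA mem_streamB => /orP[] /and3P[].
Qed.

Lemma gadj_streamAB x y u v : u != v ->
  gadj (streamA x ++ streamB y) u v = owned o EE (bits x) (bits y) (place u) (place v).
Proof.
have K a b : ((a, b) \in streamA x ++ streamB y) =
    (a < b) && owned o EE (bits x) (bits y) (place a) (place b).
  rewrite mem_cat mem_streamA mem_streamB /= /owned.
  by case: (a < b) => //=; case: ifP => //= _; rewrite orbF.
have sy a b : owned o EE (bits x) (bits y) a b = owned o EE (bits x) (bits y) b a.
  by rewrite /owned osym !(Esym _ a).
move=> uv; rewrite /gadj !K (sy (place v)) -andb_orl.
by rewrite -neq_ltn (_ : (u != v :> nat)).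
Qed.

Lemma gadget_disjoint (x y : {set T}) :
  (forall (x y : bitmap), (forall i j, ~~ (x i j && y i j)) ->
        forall f : 'I_h -> 'I_h * nat, injective f ->
          (forall a, (kind (f a).1 == None) ==> ((f a).2 == 0)) ->
          ~ (forall a b, a != b -> hE a b = owned o EE x y (f a) (f b))) ->
  [disjoint x & y] -> ~ exists V, induced_copy hE (streamA x ++ streamB y) V.
Proof.
move=> sound d [V [f [fi _ fE]]].
apply: (sound (bits x) (bits y) _ (fun a => place (f a))).
- move=> i j; apply/negP => /andP[bx bY].
  have /andP[i_m jm] := bits_lt bx.
  move: bx bY; rewrite -[i]/(val (Ordinal i_m, Ordinal jm).1).
  rewrite -[j]/(val (Ordinal i_m, Ordinal jm).2) !bitsE => tx ty.
  by move/pred0P: d => /(_ (Ordinal i_m, Ordinal jm)); rewrite /= tx ty.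
- by move=> a b /place_inj/val_inj/fi.
- by move=> a; apply: place_kind.
- move=> a b ab; rewrite fE gadj_streamAB //.
  by apply: contra_neq ab; apply: fi.
Qed.

Lemma gadget_meet (x y : {set T}) :
  (forall (x y : bitmap) i j, x i j -> y i j ->
        forall a b, a != b ->
          hE a b = owned o EE x y (a, clone_idx (kind a) i j) (b, clone_idx (kind b) i j)) ->
  ~~ [disjoint x & y] -> exists V, induced_copy hE (streamA x ++ streamB y) V.
Proof.
move=> compl /pred0Pn[[i j] /andP[/= tx ty]].
rewrite -bitsE in tx; rewrite -bitsE in ty.
have ex a : exists v : 'I_n, place v == (a, clone_idx (kind a) i j).
  have [|v _ e] := @place_onto a (clone_idx (kind a) i j); last by exists v; apply/eqP.
  by case: (kind a) => [[]|] //=.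
pose f a := xchoose (ex a).
have fP a : place (f a) = (a, clone_idx (kind a) i j) by apply/eqP/(xchooseP (ex a)).
have fi : injective f by move=> a b e; have := fP a; rewrite e fP => -[].
exists (f @: setT), f; split=> // a b.
have [->|ab] := eqVneq a b; last first.
  rewrite gadj_streamAB ?fP; first exact: compl tx ty _ _ ab.
  by apply: contra_neq ab; apply: fi.
by rewrite hirr /gadj orbb mem_cat mem_streamA mem_streamB !ltnn.
Qed.
End GadgetBound.

Lemma square_succ_le_exp n : (n * n).+1 <= 2 ^ (2 * n).
Proof.
have := ltn_expl n (ltnSn 1); rewrite mul2n -addnn expnD; move: (2 ^ n) => u; nia.
Qed.

Lemma gadget_hard (h : nat) (hE : rel 'I_h) : irreflexive hE -> gadget hE ->
  exists c N : nat, forall n p S, (N <= n)%N -> (0 < p)%N ->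
    rand_solves hE n p S -> (n ^ 2 <= c * p * S)%N.
Proof.
move=> hirr [kind [o [EE [[a0 a0k] osym Esym compl sound]]]].
case: h hE hirr kind o EE a0 a0k osym Esym compl sound => [? ? ? ? ? []//|h'].
move=> hE hirr kind o EE a0 a0k osym Esym compl sound; set h := h'.+1.
(* [2304 = 4 * 576], from [n <= 2 * h * m] squared and from [disjointness_bound]. The threshold
   [60 * C] makes the terms without [p * S] at most half of [n ^ 2], which doubles [24 * C] to
   [48 * C]. *)
pose C := 2304 * (h * h).
exists (48 * C), (60 * C) => n p S nN p0 rs.
pose m := n %/ h.
have hn : 2 * h <= n by apply: leq_trans nN; rewrite /C; nia.
have nm : n < m.+1 * h by apply: ltn_ceil.
have hm : m * h <= n by rewrite leq_divM.
have m0 : 0 < m by rewrite divn_gt0 //; lia.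
pose K := (m * m) %/ 576 - 1.
have C0 : 0 < C by rewrite /C; nia.
have n2 : n <= 2 * h * m by nia.
have n4 : n * n <= 4 * (h * h) * (m * m) by nia.
have [mm|mm] := leqP (m * m) 575.
  exfalso; have : n * n <= C by rewrite /C; clear -n4 mm; nia.
  have : 60 * C <= n * n.
    by apply: leq_trans nN _; rewrite leq_pmulr //; lia.
  by clear -C0; lia.
have K576 : 576 * K.+1 <= #|{: 'I_m * 'I_m}|.
  rewrite card_prod !card_ord /K subn1 prednK ?divn_gt0 //.
  by rewrite mulnC leq_divM.
have := stream_bound (valid_streamAB kind o EE a0 n (m := m))
  (fun x y => gadget_disjoint a0k osym Esym m0 sound)
  (fun x y => gadget_meet hirr a0 osym Esym hm m0 compl) rs K576.
set Q := _ * (_ * _) => H.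
have Qle : Q <= 2 ^ (2 * n + 3 * (p * S)).
  rewrite /Q expnD leq_mul ?square_succ_le_exp //.
  rewrite -expnD -expnM -expnD leq_exp2l //; clear -p0; nia.
have {}H : 2 ^ K <= 2 ^ (12 + (2 * n + 3 * (p * S)) * 8).
  apply: leq_trans H _; rewrite expnD leq_mul2l; apply/orP; right.
  by rewrite expnM leq_exp2r.
rewrite leq_exp2l // in H.
have mK : m * m <= 576 * (K + 2).
  have := ltn_ceil (m * m) (isT : 0 < 576); rewrite /K.
  by move: (_ %/ _) => r; clear; lia.
have : n * n <= C * (14 + 16 * n + 24 * (p * S)).
  apply: leq_trans n4 _.
  apply: (@leq_trans (4 * (h * h) * (576 * (K + 2)))); first by rewrite leq_mul2l mK orbT.
  have -> : 4 * (h * h) * (576 * (K + 2)) = C * (K + 2) by rewrite /C; lia.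
  rewrite leq_mul2l; apply/orP; right; clear -H; lia.
have : 60 * C * n <= n * n by rewrite leq_mul2r nN orbT.
rewrite -mulnn -!mulnA; have : 0 < n by lia.
by move: (p * S) => u; clear; nia.
Qed.

(** * Graphs with a triangle *)

Lemma gadget_compl (h : nat) (hE : rel 'I_h) : gadget (co_rel hE) -> gadget hE.
Proof.
move=> [kind [o [EE [a0 osym Esym compl sound]]]].
exists kind, o, (fun x u v => ~~ EE x u v).
have ow x y u v : owned o (fun x u v => ~~ EE x u v) x y u v = ~~ owned o EE x y u v.
  by rewrite /owned; case: ifP.
split=> //.
- by move=> x u v; rewrite Esym.
- move=> x y i j xij yij a b ab; rewrite ow -(compl x y i j xij yij _ _ ab).
  by rewrite /co_rel ab negbK.
- move=> x y dis f fi pf fE; apply: (sound x y dis f fi pf) => a b ab.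
  by rewrite /co_rel ab fE // ow negbK.
Qed.

Inductive label (h : nat) (R C : Type) : Type :=
  | Fix of 'I_h | Row of R & 'I_h | Col of C.
Arguments Fix {h R C}. Arguments Row {h R C}. Arguments Col {h R C}.

Section Triangle.
Variables (h : nat) (hE : rel 'I_h).
Hypotheses (hsym : symmetric hE) (hirr : irreflexive hE).

Definition triangle_free (A : {set 'I_h}) : bool :=
  [forall a in A, forall b in A, forall c in A, ~~ [&& hE a b, hE b c & hE a c]].

Variables (S : {set 'I_h}) (s : 'I_h).

(* Hosts for H: S is a minimum set meeting all triangles and s lies in S. A host
   has the fixed vertices S :\ s, disjoint copies (rows) of H - S and clones
   (columns) of s; A r c says which vertices of row r the column c sees. *)
Definition host_adj (R C : eqType) (A : R -> C -> {set 'I_h}) : rel (label h R C) :=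
  fun u v => match u, v with
  | Fix a, Fix b => hE a b
  | Fix a, Row _ p | Row _ p, Fix a => hE a p
  | Fix a, Col _ | Col _, Fix a => hE a s
  | Row r p, Row r' q => (r == r') && hE p q
  | Row r p, Col c | Col c, Row r p => p \in A r c
  | Col _, Col _ => false
  end.

Definition proper_label (R C : Type) (u : label h R C) : bool :=
  match u with Fix a => a \in S :\ s | Row _ p => p \in ~: S | Col _ => true end.

(* Only the at most b columns of bad may see k vertices of a row, all others
   see fewer. *)
Definition hosted k b : Prop :=
  exists (R C : eqType) (A : R -> C -> {set 'I_h}) (bad : seq C) (f : 'I_h -> label h R C),
  [/\ size bad <= b, forall r c, #|A r c| < k + (c \in bad), injective f,
      forall a, proper_label (f a) & forall a b, hE a b = host_adj A (f a) (f b)].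

(** H is a host of itself: one row carrying H - S and one column, the vertex [s] with its true
    neighbourhood. *)
Lemma hosted_init : hosted h 1.
Proof.
exists unit, unit, (fun _ _ => [set p in ~: S | hE p s]), [:: tt].
exists (fun a => if a \in S then (if a == s then Col tt else Fix a) else Row tt a).
split=> //.
- by move=> r []; rewrite addn1 ltnS -[X in _ <= X]card_ord max_card.
- move=> a b; case: (boolP (a \in S)) => aS; case: (boolP (b \in S)) => bS //=.
  + by case: (eqVneq a s) => [->|_]; case: (eqVneq b s) => [->|_] // [].
  + by case: ifP.
  + by case: ifP.
  + by case.
- move=> a; case: (boolP (a \in S)) => aS /=; last by rewrite inE aS.
  by case: (eqVneq a s) => //= as_; rewrite !inE as_ aS.
- move=> a b; case: (boolP (a \in S)) => aS; case: (boolP (b \in S)) => bS //=.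
  + case: (eqVneq a s) => [->|_]; case: (eqVneq b s) => [->|_] //=.
  + by case: (eqVneq a s) => [->|_] //=; rewrite !inE bS /= hsym.
  + by case: (eqVneq b s) => [->|_] //=; rewrite ?inE ?aS // hsym.
Qed.

(** Only the finitely many columns met by the copy of H matter: they become the bad ones for the
    smaller bound, and all others are emptied. *)
Lemma hosted_drop k : 0 < k -> hosted k.+1 0 -> exists b, hosted k b.
Proof.
move=> k0 [R [C [A [bad [f [sb sA fi pf fE]]]]]].
pose cols := flatten [seq (if f a is Col c then [:: c] else [::]) | a <- enum 'I_h].
have colsP a c : f a = Col c -> c \in cols.
  move=> fa; apply/flattenP; exists [:: c]; rewrite ?inE //.
  by apply/mapP; exists a; rewrite ?mem_enum // fa.
exists (size cols), R, C, (fun r c => if c \in cols then A r c else set0), cols, f.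
split=> //.
- move=> r c; have := sA r c; case: ifP => cc; last by rewrite cards0 addn0.
  by move: sb; rewrite leqn0 size_eq0 => /eqP ->; rewrite in_nil addn0 addn1.
- move=> a b; rewrite fE; case fa: (f a) => [x|r p|c]; case fb: (f b) => [y|r' q|c'] //=.
    by rewrite (colsP _ _ fb).
  by rewrite (colsP _ _ fa).
Qed.

(* Clone all rows and one bad column j0, splitting A r j0 into two smaller parts
   controlled by the two players. If this is not a gadget, then H sits in a
   disjoint instance, in which the clones of j0 are no longer bad. *)
Lemma hosted_step k b : 1 < k -> hosted k b.+1 -> gadget hE \/ hosted k b.
Proof.
move=> k1 [R [C [A [[|j0 bad] [f [sb sA fi pf fE]]]]]].
  by right; exists R, C, A, [::], f.
case: (classic (hosted k b)) => [|nh]; first by right.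
left.
(* One vertex for the first player and the rest for the second; as [1 < k], both parts have fewer
   than [k] vertices. *)
pose B1 r : {set 'I_h} := if [pick p in A r j0] is Some p then [set p] else set0.
pose B2 r := A r j0 :\: B1 r.
have B1A r : B1 r \subset A r j0.
  by rewrite /B1; case: pickP => [p pA|_]; rewrite ?sub1set ?sub0set.
have B12 r : B1 r :|: B2 r = A r j0.
  by rewrite /B2 setDE setUIr setUCr setIT; apply/setUidPr.
have sB1 r : #|B1 r| < k by rewrite /B1; case: pickP => [p _|_]; rewrite ?cards1 ?cards0 //; lia.
have sB2 r : #|B2 r| < k.
  have := sA r j0; rewrite inE eqxx addn1 ltnS /B2 /B1; case: pickP => [p pA|e _].
    by rewrite (cardsD1 p) pA.
  by rewrite setD0 (_ : A r j0 = set0) ?cards0; [lia|apply/setP => p; rewrite e inE].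
pose A' (x y : bitmap) (r : R * nat) (c : C * nat) : {set 'I_h} :=
  if c.1 == j0 then
    (if x r.2 c.2 then B1 r.1 else set0) :|: (if y r.2 c.2 then B2 r.1 else set0)
  else if c.2 == 0 then A r.1 c.1 else set0.
pose lab (u : 'I_h * nat) : label h (R * nat) (C * nat) :=
  match f u.1 with
  | Fix a => Fix a | Row r p => Row (r, u.2) p | Col c => Col (c, u.2) end.
pose kind a : option bool := match f a with
  | Fix _ => None | Row _ _ => Some true
  | Col c => if c == j0 then Some false else None end.
pose o : rel ('I_h * nat) := fun u v => match f u.1, f v.1 with
  | Row r p, Col c | Col c, Row r p => p \in B1 r | _, _ => false end.
pose EE (x : bitmap) : rel ('I_h * nat) := fun u v => host_adj (A' x x) (lab u) (lab v).
have adj_sym (R' C' : eqType) (A0 : R' -> C' -> {set 'I_h}) u v :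
    host_adj A0 u v = host_adj A0 v u.
  by case: u v => [a|r p|c] [a'|r' p'|c'] //=; rewrite eq_sym hsym.
have inA' x y r i c j p : (p \in A' x y (r, i) (c, j)) =
    (p \in (if p \in B1 r then A' x x (r, i) (c, j) else A' y y (r, i) (c, j))).
  rewrite /A' /=; case: (c == j0) => //=; last by case: (p \in B1 r).
  by case: (boolP (p \in B1 r)) => pB; case: (x i j); case: (y i j);
     rewrite !inE ?pB ?(negbTE pB).
have ow x y u v : owned o EE x y u v = host_adj (A' x y) (lab u) (lab v).
  case: u v => [a i] [a' i']; rewrite /owned /o /EE /lab /=.
  case: (f a) => [z|r p|c]; case: (f a') => [z'|r' p'|c'] //=.
    by rewrite [RHS]inA'; case: ifP.
  by rewrite [RHS]inA'; case: ifP.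
(* If the copy avoided column [j0], emptying this column would host H with one bad column fewer. *)
have [a0 fa0] : exists a, f a = Col j0.
  apply: NNPP => no; apply: nh.
  exists R, C, (fun r c => if c == j0 then set0 else A r c), bad, f; split=> //.
    move=> r c; have := sA r c; rewrite inE.
    by case: (c == j0) => //= _; rewrite cards0; lia.
  move=> a a'; rewrite fE; case fa: (f a) => [x|r p|c]; case fb: (f a') => [y|r' q|c'] //=.
    by case: eqP => // e; case: no; exists a'; rewrite fb e.
  by case: eqP => // e; case: no; exists a; rewrite fa e.
exists kind, o, EE; split.
- by exists a0; rewrite /kind fa0 eqxx.
- move=> [a i] [a' i']; rewrite /o /=.
  by case: (f a) => [z|r p|c]; case: (f a') => [z'|r' p'|c'].
- by move=> x u v; apply: adj_sym.
- move=> x y i j xij yij a a' _; rewrite ow fE /lab /kind /=.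
  case: (f a) => [z|r p|c]; case: (f a') => [z'|r' p'|c'] //=.
  + by rewrite xpair_eqE eqxx andbT.
  + rewrite /A' /=; have [->|] := eqVneq c' j0; rewrite /= ?eqxx //.
    by rewrite xij yij B12.
  + rewrite /A' /=; have [->|] := eqVneq c j0; rewrite /= ?eqxx //.
    by rewrite xij yij B12.
- move=> x y dis g gi pg gE; apply: nh.
  exists (R * nat)%type, (C * nat)%type, (A' x y), [seq (c, 0) | c <- bad], (fun a => lab (g a)).
  split.
  + by rewrite size_map.
  + move=> [r i] [c j]; rewrite /A' /=; have [->|cj] := eqVneq c j0.
      apply: (@leq_trans k); last exact: leq_addr.
      move: (dis i j); case: (x i j); case: (y i j) => //= _; rewrite ?setU0 ?set0U //.
      by rewrite cards0; lia.
    case: eqP => [->|_]; last by rewrite cards0; lia.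
    have := sA r c; rewrite inE (negbTE cj) /= mem_map // => ? ? [].
    by [].
  + move=> a a' e; apply: gi; move: (pg a) (pg a') e; rewrite /lab /kind.
    case: (g a) (g a') => [t i] [t' i'] /=.
    case ft: (f t) => [z|r p|c]; case ft': (f t') => [z'|r' p'|c'] //=.
    * move=> /eqP -> /eqP -> [] e; congr (_, _); apply: fi; by rewrite ft ft' e.
    * move=> _ _ [] e1 e2 e3; rewrite e2; congr (_, _); apply: fi; by rewrite ft ft' e1 e3.
    * move=> _ _ [] e1 e2; rewrite e2; congr (_, _); apply: fi; by rewrite ft ft' e1.
  + by move=> a; rewrite /lab; have := pf (g a).1; case: (f _).
  + move=> a a'; have [->|aa'] := eqVneq a a'; last by rewrite gE // ow.
    by rewrite hirr; case: (lab _) => //= ? ?; rewrite ?hirr ?eqxx.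
Qed.
Hypotheses (sS : s \in S) (Stf : triangle_free (~: S)).
Hypothesis Smin : forall F : {set 'I_h}, #|F| < #|S| -> ~~ triangle_free (~: F).

(* If every column sees at most one vertex of each row, then all triangles meet the
   fewer than #|S| fixed vertices. *)
Lemma hosted_base b : ~ hosted 1 b.
Proof.
move=> [R [C [A [bad [f [_ sA fi pf fE]]]]]].
pose fixpart a := if f a is Fix x then x else s.
pose F := [set a | if f a is Fix _ then true else false].
have cF : #|F| < #|S|.
  rewrite (cardsD1 s S) sS add1n ltnS -(card_in_imset (f := fixpart)).
    apply/subset_leq_card/subsetP => z /imsetP[a]; rewrite !inE /fixpart.
    by have := pf a; case: (f a) => //= x + _ ->; rewrite !inE.
  move=> a a'; rewrite !inE /fixpart => Fa Fa' e; apply: fi; move: Fa Fa' e.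
  by case: (f a) => // x; case: (f a') => // y _ _ ->.
have sA' r c p q : p \in A r c -> q \in A r c -> p = q.
  move=> pA qA; apply/eqP; apply: contraT => pq.
  have : #|A r c| <= 1 by have := sA r c; case: (c \in bad); lia.
  have : [set p; q] \subset A r c.
    by apply/subsetP => z; rewrite !inE => /orP[] /eqP ->.
  by move/subset_leq_card; rewrite cards2 pq /= => ? ?; lia.
have tfP p q r : p \in ~: S -> q \in ~: S -> r \in ~: S ->
    hE p q -> hE q r -> hE p r -> False.
  move=> pS qS rS pq qr pr; move/forall_inP: Stf => /(_ p pS)/forall_inP/(_ q qS).
  by move/forall_inP/(_ r rS); rewrite pq qr pr.
move: (Smin cF) => /forall_inPn[a aF] /forall_inPn[b' bF] /forall_inPn[c cF'].
rewrite negbK => /and3P[]; rewrite !fE.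
have rr (r : R) (x y : 'I_h) (cc : C) : x \in A r cc -> y \in A r cc -> hE x y -> False.
  by move=> xA yA; rewrite (sA' _ _ _ _ xA yA) hirr.
move: aF bF cF' (pf a) (pf b') (pf c); rewrite !inE.
case: (f a) => [//|ra pa|ca]; case: (f b') => [//|rb pb|cb];
  case: (f c) => [//|rc pc|cc] //= _ _ _ Pa Pb Pc.
- by move=> /andP[_ h1] /andP[_ h2] /andP[_ h3]; apply: (tfP pa pb pc).
- by move=> /andP[/eqP <- h1] h2 h3; apply: (rr _ _ _ _ h3 h2 h1).
- by move=> h1 h2 /andP[/eqP e h3]; subst rc; apply: (rr _ _ _ _ h1 h2 h3).
- by move=> h1 /andP[/eqP e h2] h3; subst rc; apply: (rr _ _ _ _ h1 h3 h2).
Qed.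

End Triangle.

(** Lexicographic descent on [(k, l)]: [hosted_step] lowers [l], [hosted_drop] lowers [k] once [l]
    is 0, and [k = 1] is impossible; a gadget is the only way out. *)
Lemma triangle_gadget (h : nat) (hE : rel 'I_h) a b c :
  symmetric hE -> irreflexive hE -> hE a b -> hE b c -> hE a c -> gadget hE.
Proof.
move=> hsym hirr ab bc ac.
have tfT : triangle_free hE (~: setT).
  by rewrite setCT; apply/forall_inP => x; rewrite inE.
pose S := [arg min_(S < setT | triangle_free hE (~: S)) #|S|].
have [Stf Smin] : triangle_free hE (~: S) /\
    forall F : {set 'I_h}, #|F| < #|S| -> ~~ triangle_free hE (~: F).
  rewrite /S; case: arg_minnP => // S' tf' min'; split=> // F.
  by rewrite ltnNge; apply: contra => /min'.
have [s sS] : exists s, s \in S.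
  apply/set0Pn; apply: contraTneq Stf => ->; apply/forall_inPn; exists a; rewrite ?inE //.
  apply/forall_inPn; exists b; rewrite ?inE //.
  by apply/forall_inPn; exists c; rewrite ?inE // negbK ab bc ac.
suff gen k : 0 < k -> forall l, hosted hE S s k l -> gadget hE.
  by apply: (gen h _ 1); [apply: leq_trans (ltn_ord a) | apply: hosted_init].
elim: k => // k IH _; case: (posnP k) IH => [-> _ l|k0 IH].
  by move/(hosted_base hirr sS Stf Smin).
elim=> [|l IHl] H; last first.
  by case: (hosted_step hsym hirr _ H) => // /IHl.
by have [l] := hosted_drop k0 H; apply: IH.
Qed.

(** * The cycles C4 and C5 *)

Lemma gadget_iso (h l : nat) (hE : rel 'I_h) (hE' : rel 'I_l) :
  graph_iso hE hE' -> gadget hE' -> gadget hE.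
Proof.
move=> [s [[s' sK s'K] sE]] [kind [o [EE [[a0 a0k] osym Esym compl sound]]]].
pose t (u : 'I_h * nat) := (s u.1, u.2).
exists (fun a => kind (s a)), (fun u v => o (t u) (t v)), (fun x u v => EE x (t u) (t v)).
split=> //.
- by exists (s' a0); rewrite s'K.
- by move=> x u v /=; rewrite Esym.
- move=> x y i j xij yij a b ab; rewrite sE (compl x y i j xij yij) //.
  by apply: contra_neq ab => /(can_inj sK).
- move=> x y dis f fi pf fE; apply: (sound x y dis (fun b => t (f (s' b)))).
  + move=> a b [] /(can_inj sK) e1 e2; apply: (can_inj s'K); apply: fi.
    by rewrite [LHS]surjective_pairing e1 e2 -surjective_pairing.
  + by move=> a; apply: pf.
  + move=> a b ab; rewrite -{1}(s'K a) -{1}(s'K b) -sE fE //.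
    by apply: contra_neq ab => /(can_inj s'K).
Qed.

Definition cycle_rel (l : nat) : rel 'I_l :=
  fun i j => (i.+1 %% l == j) || (j.+1 %% l == i).

(* Blow-up of the cycle 0123: 0 is fixed, 1 and 2 are matched rows, and 3 is a
   column whose clones form a clique. *)
Definition c4_adj (x y : bitmap) (u v : nat * nat) : bool :=
  match u.1, v.1 with
  | 0, 1 | 1, 0 | 0, 3 | 3, 0 => true
  | 1, 2 | 2, 1 => u.2 == v.2
  | 1, 3 => ~~ x u.2 v.2
  | 3, 1 => ~~ x v.2 u.2
  | 2, 3 => y u.2 v.2
  | 3, 2 => y v.2 u.2
  | 3, 3 => u.2 != v.2
  | _, _ => false
  end.

(* Blow-up of the cycle 01234: 0 and 1 are fixed, 2 and 3 are matched rows, and 4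
   is a column; all classes are independent sets. *)
Definition c5_adj (x y : bitmap) (u v : nat * nat) : bool :=
  match u.1, v.1 with
  | 0, 1 | 1, 0 | 0, 4 | 4, 0 | 1, 2 | 2, 1 => true
  | 2, 3 | 3, 2 => u.2 == v.2
  | 2, 4 => ~~ x u.2 v.2
  | 4, 2 => ~~ x v.2 u.2
  | 3, 4 => y u.2 v.2
  | 4, 3 => y v.2 u.2
  | _, _ => false
  end.

Ltac close_case dis :=
  repeat match goal with
  | H : is_true (_ == _) |- _ => move/eqP: H => H; subst
  | H : (_ == _) = false |- _ => move/negbT/eqP: H => H
  | H : is_true (_ != _) |- _ => move/eqP: H => H
  | H : (~~ _) = false |- _ => move/negbFE: H => H
  end;
  first
  [ congruence
  | match goal with
    | H1 : is_true (?x ?i ?j), H2 : is_true (?y ?i ?j) |- _ =>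
        by move: (dis i j); rewrite H1 H2
    end ].

(** Each choice of classes either contradicts the index equations or exhibits a pair of indices set
    in both bitmaps. Adjacency separates consecutive vertices, so distinctness is stated for the
    diagonals. *)
Lemma c4_adj_free (x y : bitmap) : (forall i j, ~~ (x i j && y i j)) ->
  forall a0 a1 a2 a3 i0 i1 i2 i3 : nat,
  a0 < 4 -> a1 < 4 -> a2 < 4 -> a3 < 4 ->
  (a0 = 0 -> i0 = 0) -> (a1 = 0 -> i1 = 0) -> (a2 = 0 -> i2 = 0) -> (a3 = 0 -> i3 = 0) ->
  (a0, i0) <> (a2, i2) -> (a1, i1) <> (a3, i3) ->
  c4_adj x y (a0, i0) (a1, i1) -> c4_adj x y (a1, i1) (a2, i2) ->
  c4_adj x y (a2, i2) (a3, i3) -> c4_adj x y (a3, i3) (a0, i0) ->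
  c4_adj x y (a0, i0) (a2, i2) = false -> c4_adj x y (a1, i1) (a3, i3) = false -> False.
Proof.
move=> dis a0 a1 a2 a3 i0 i1 i2 i3 l0 l1 l2 l3 z0 z1 z2 z3 n02 n13 h01 h12 h23 h30 h02 h13.
rewrite /c4_adj /= in h01 h12 h23 h30 h02 h13.
case: a0 l0 z0 n02 h01 h30 h02 => [|[|[|[|a0]]]] //= _ z0 n02;
case: a1 l1 z1 n13 h12 h13 => [|[|[|[|a1]]]] //= _ z1 n13;
case: a2 l2 z2 n02 h23 => [|[|[|[|a2]]]] //= _ z2 n02;
case: a3 l3 z3 n13 => [|[|[|[|a3]]]] //= _ z3 n13; intros;
try (have {}z0 := z0 erefl); try (have {}z1 := z1 erefl);
try (have {}z2 := z2 erefl); try (have {}z3 := z3 erefl); subst.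
all: try close_case dis.
Qed.

Lemma c5_adj_free (x y : bitmap) : (forall i j, ~~ (x i j && y i j)) ->
  forall a0 a1 a2 a3 a4 i0 i1 i2 i3 i4 : nat,
  a0 < 5 -> a1 < 5 -> a2 < 5 -> a3 < 5 -> a4 < 5 ->
  (a0 < 2 -> i0 = 0) -> (a1 < 2 -> i1 = 0) -> (a2 < 2 -> i2 = 0) ->
  (a3 < 2 -> i3 = 0) -> (a4 < 2 -> i4 = 0) ->
  (a0, i0) <> (a2, i2) -> (a0, i0) <> (a3, i3) -> (a1, i1) <> (a3, i3) ->
  (a1, i1) <> (a4, i4) -> (a2, i2) <> (a4, i4) ->
  c5_adj x y (a0, i0) (a1, i1) -> c5_adj x y (a1, i1) (a2, i2) ->
  c5_adj x y (a2, i2) (a3, i3) -> c5_adj x y (a3, i3) (a4, i4) ->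
  c5_adj x y (a4, i4) (a0, i0) ->
  c5_adj x y (a0, i0) (a2, i2) = false -> c5_adj x y (a0, i0) (a3, i3) = false ->
  c5_adj x y (a1, i1) (a3, i3) = false -> c5_adj x y (a1, i1) (a4, i4) = false ->
  c5_adj x y (a2, i2) (a4, i4) = false -> False.
Proof.
move=> dis a0 a1 a2 a3 a4 i0 i1 i2 i3 i4 l0 l1 l2 l3 l4 z0 z1 z2 z3 z4 n02 n03 n13 n14 n24.
rewrite /c5_adj /= => h01 h12 h23 h34 h40 h02 h03 h13 h14 h24.
case: a0 l0 z0 n02 n03 h01 h40 h02 h03 => [|[|[|[|[|a0]]]]] //= _ z0 n02 n03;
case: a1 l1 z1 n13 n14 h12 h13 h14 => [|[|[|[|[|a1]]]]] //= _ z1 n13 n14;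
case: a2 l2 z2 n02 n24 h23 h24 => [|[|[|[|[|a2]]]]] //= _ z2 n02 n24;
case: a3 l3 z3 n13 n03 h34 => [|[|[|[|[|a3]]]]] //= _ z3 n13 n03;
case: a4 l4 z4 n14 n24 => [|[|[|[|[|a4]]]]] //= _ z4 n14 n24; intros;
try (have {}z0 := z0 erefl); try (have {}z1 := z1 erefl);
try (have {}z2 := z2 erefl); try (have {}z3 := z3 erefl);
try (have {}z4 := z4 erefl); subst.
all: try close_case dis.
Qed.

Lemma cycle4_gadget : gadget (@cycle_rel 4).
Proof.
pose t (u : 'I_4 * nat) : nat * nat := (val u.1, u.2).
pose kind (a : 'I_4) : option bool := if val a == 0 then None else Some (val a != 3).
pose o : rel ('I_4 * nat) := fun u v =>
  ((val u.1 == 1) && (val v.1 == 3)) || ((val u.1 == 3) && (val v.1 == 1)).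
pose EE (z : bitmap) : rel ('I_4 * nat) := fun u v => c4_adj z z (t u) (t v).
have ow x y u v : owned o EE x y u v = c4_adj x y (t u) (t v).
  rewrite /owned /o /EE /t; case: u v => [[[|[|[|[|[|]]]]] //= _] i] [[[|[|[|[|[|]]]]] //= _] j].
exists kind, o, EE; split.
- by exists (inord 2); rewrite /kind /= inordK.
- by move=> u v; rewrite /o orbC andbC [X in _ || X]andbC.
- move=> x; rewrite /EE /t => -[[[|[|[|[|[|]]]]] //= _] i] [[[|[|[|[|[|]]]]] //= _] j] //;
    by rewrite /c4_adj /= eq_sym.
- move=> x y i j xij yij; rewrite /kind => -[[|[|[|[|[|]]]]] //= la] [[|[|[|[|[|]]]]] //= lb] ab;
    by rewrite ow /c4_adj /= ?xij ?yij ?eqxx //.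
- move=> x y dis f fi pf fE.
  have E i j (li : i < 4) (lj : j < 4) : i != j ->
      c4_adj x y (t (f (Ordinal li))) (t (f (Ordinal lj))) = cycle_rel (Ordinal li) (Ordinal lj).
    by move=> ij; rewrite -ow -fE.
  have D i j (li : i < 4) (lj : j < 4) : i != j -> t (f (Ordinal li)) <> t (f (Ordinal lj)).
    move=> /eqP ij e; apply: ij; suff [] : Ordinal li = Ordinal lj by [].
    apply: fi; rewrite [LHS]surjective_pairing [RHS]surjective_pairing.
    by case: e => /val_inj -> ->.
  have Z i (li : i < 4) : val (f (Ordinal li)).1 = 0 -> (f (Ordinal li)).2 = 0.
    by move=> z; have := pf (Ordinal li); rewrite /kind z /= => /eqP.
  by apply: (@c4_adj_free x y dis _ _ _ _ _ _ _ _
    (ltn_ord (f (@Ordinal 4 0 isT)).1) (ltn_ord (f (@Ordinal 4 1 isT)).1)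
    (ltn_ord (f (@Ordinal 4 2 isT)).1) (ltn_ord (f (@Ordinal 4 3 isT)).1)
    (Z _ _) (Z _ _) (Z _ _) (Z _ _) (D _ _ _ _ _) (D _ _ _ _ _));
    rewrite ?E.
Qed.

Lemma cycle5_gadget : gadget (@cycle_rel 5).
Proof.
pose t (u : 'I_5 * nat) : nat * nat := (val u.1, u.2).
pose kind (a : 'I_5) : option bool := if val a < 2 then None else Some (val a != 4).
pose o : rel ('I_5 * nat) := fun u v =>
  ((val u.1 == 2) && (val v.1 == 4)) || ((val u.1 == 4) && (val v.1 == 2)).
pose EE (z : bitmap) : rel ('I_5 * nat) := fun u v => c5_adj z z (t u) (t v).
have ow x y u v : owned o EE x y u v = c5_adj x y (t u) (t v).
  rewrite /owned /o /EE /t; case: u v => [[[|[|[|[|[|]]]]] //= _] i] [[[|[|[|[|[|]]]]] //= _] j].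
exists kind, o, EE; split.
- by exists (inord 2); rewrite /kind /= inordK.
- by move=> u v; rewrite /o orbC andbC [X in _ || X]andbC.
- move=> x; rewrite /EE /t => -[[[|[|[|[|[|]]]]] //= _] i] [[[|[|[|[|[|]]]]] //= _] j] //;
    by rewrite /c5_adj /= eq_sym.
- move=> x y i j xij yij; rewrite /kind => -[[|[|[|[|[|]]]]] //= la] [[|[|[|[|[|]]]]] //= lb] ab;
    by rewrite ow /c5_adj /= ?xij ?yij ?eqxx //.
- move=> x y dis f fi pf fE.
  have E i j (li : i < 5) (lj : j < 5) : i != j ->
      c5_adj x y (t (f (Ordinal li))) (t (f (Ordinal lj))) = cycle_rel (Ordinal li) (Ordinal lj).
    by move=> ij; rewrite -ow -fE.
  have D i j (li : i < 5) (lj : j < 5) : i != j -> t (f (Ordinal li)) <> t (f (Ordinal lj)).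
    move=> /eqP ij e; apply: ij; suff [] : Ordinal li = Ordinal lj by [].
    apply: fi; rewrite [LHS]surjective_pairing [RHS]surjective_pairing.
    by case: e => /val_inj -> ->.
  have Z i (li : i < 5) : val (f (Ordinal li)).1 < 2 -> (f (Ordinal li)).2 = 0.
    by move=> z; have := pf (Ordinal li); rewrite /kind z /= => /eqP.
  by apply: (@c5_adj_free x y dis _ _ _ _ _ _ _ _ _ _
    (ltn_ord (f (@Ordinal 5 0 isT)).1) (ltn_ord (f (@Ordinal 5 1 isT)).1)
    (ltn_ord (f (@Ordinal 5 2 isT)).1) (ltn_ord (f (@Ordinal 5 3 isT)).1)
    (ltn_ord (f (@Ordinal 5 4 isT)).1)
    (Z _ _) (Z _ _) (Z _ _) (Z _ _) (Z _ _)
    (D _ _ _ _ _) (D _ _ _ _ _) (D _ _ _ _ _) (D _ _ _ _ _) (D _ _ _ _ _));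
    rewrite ?E.
Qed.

(** * Small graphs *)

Section Tables.
Variable h : nat.
Definition pairs : seq (nat * nat) := [seq (i, j) | j <- iota 0 h, i <- iota 0 j].
Definition table_adj (bits : seq bool) (i j : nat) : bool :=
  (i != j) && nth false bits (index (minn i j, maxn i j) pairs).
Definition homogeneous (e : nat -> nat -> bool) : bool :=
  has (fun t => [&& t.1.1 < t.1.2, t.1.2 < t.2, e t.1.1 t.1.2 == e t.1.2 t.2
                 & e t.1.1 t.1.2 == e t.1.1 t.2])
    [seq (ij, k) | ij <- [seq (i, j) | i <- iota 0 h, j <- iota 0 h], k <- iota 0 h].
Definition relabels (e T : nat -> nat -> bool) (p : seq nat) : bool :=
  all (fun i => all (fun j => e i j == T (nth 0 p i) (nth 0 p j)) (iota 0 h)) (iota 0 h).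
(* The conditional, unlike ||, is lazy under vm_compute. *)
Definition classified (Ts : seq (nat -> nat -> bool)) (bits : seq bool) : bool :=
  if homogeneous (table_adj bits) then true else
  has (fun T => has (relabels (table_adj bits) T) (permutations (iota 0 h))) Ts.
Fixpoint bitseqs (n : nat) : seq (seq bool) :=
  if n is n'.+1 then [seq b :: s | b <- [:: true; false], s <- bitseqs n'] else [:: [::]].
End Tables.

Definition path_nat (i j : nat) : bool := (i.+1 == j) || (j.+1 == i).
Definition cycle_nat l (i j : nat) : bool := (i.+1 %% l == j) || (j.+1 %% l == i).
Definition co_nat (T : nat -> nat -> bool) (i j : nat) : bool := (i != j) && ~~ T i j.

Lemma mem_bitseqs (s : seq bool) : s \in bitseqs (size s).
Proof.
elim: s => // b s IH; apply/(@allpairsPdep _ _ _ cons); exists b, s; split=> //.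
by case: b.
Qed.

(** The lengths 3, 6 and 10 of the bit strings are the numbers of vertex pairs;
    [co_nat (cycle_nat 4)] below is 2K2. *)
Lemma classified3 : all (classified 3 [:: path_nat; co_nat path_nat]) (bitseqs 3).
Proof. by vm_compute. Qed.
Lemma classified4 :
  all (classified 4 [:: path_nat; cycle_nat 4; co_nat (cycle_nat 4)]) (bitseqs 6).
Proof. by vm_compute. Qed.
Lemma classified5 : all (classified 5 [:: cycle_nat 5]) (bitseqs 10).
Proof. by vm_compute. Qed.

Definition has_homogeneous (h : nat) (hE : rel 'I_h) : Prop :=
  exists v a b c, [/\ a != b, b != c, a != c & [/\ hE a b = v, hE b c = v & hE a c = v]].

Lemma classified_sound (h' : nat) (hE : rel 'I_h'.+1) Ts :
  symmetric hE -> irreflexive hE ->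
  all (classified h'.+1 Ts) (bitseqs (size (pairs h'.+1))) ->
  has_homogeneous hE \/
  exists2 T, List.In T Ts & graph_iso hE (fun i j : 'I_h'.+1 => T i j).
Proof.
set h := h'.+1 => hsym hirr /allP al.
pose bits := [seq hE (inord p.1) (inord p.2) | p <- pairs h].
have tE i j : i < h -> j < h -> table_adj h bits i j = hE (inord i) (inord j).
  move=> ih jh; rewrite /table_adj; have [->|ij] /= := eqVneq i j; first by rewrite hirr.
  have inp : (minn i j, maxn i j) \in pairs h.
    by apply/allpairsPdep; exists (maxn i j), (minn i j); rewrite !mem_iota; split=> //; lia.
  rewrite (nth_map (0, 0)) ?index_mem // nth_index //=.
  by case: (ltngtP i j) ij => // _ _; rewrite hsym.
have := al bits; rewrite -(size_map (fun p => hE (inord p.1) (inord p.2)) (pairs h)).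
move=> /(_ (mem_bitseqs _)); rewrite /classified; case: ifP => [+ _|_].
  case/hasP => -[[i j] k] /allpairsPdep[ij' [k' [ijin kin [e1 e2]]]] /=.
  move: ijin kin; rewrite -e1 -e2 => /allpairsPdep[i'' [j'' [ih jh [e3 e4]]]] kh.
  move: ih jh kh; rewrite -e3 -e4 !mem_iota /= !add0n => ih jh kh.
  case/and4P => ij jk; rewrite !tE // => /eqP v1 /eqP v2; left.
  have ne u v : u < v -> v < h -> inord u != inord v :> 'I_h.
    move=> uv vh; apply/eqP => /(congr1 val); rewrite /= !inordK //; last exact: ltn_trans vh.
    by move=> e; rewrite e ltnn in uv.
  exists (hE (inord i) (inord j)), (inord i), (inord j), (inord k).
  by split; [exact: ne|exact: ne|apply: ne kh; exact: ltn_trans jk|split].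
move=> hs; right; elim: Ts hs {al} => //= T Ts IH /orP[|/IH[T' T'in iT]]; last first.
  by exists T' => //; right.
case/hasP => p; rewrite mem_permutations => pp0 rp.
have pp : perm_eq p (iota 0 h) by exact: pp0.
exists T; first by left.
have sp : size p = h by rewrite (perm_size pp) size_iota.
have up : uniq p by rewrite (perm_uniq pp) iota_uniq.
have np i : i < h -> nth 0 p i < h.
  move=> ih; have : nth 0 p i \in p by rewrite mem_nth ?sp.
  by rewrite (perm_mem pp) mem_iota add0n.
exists (fun a : 'I_h => inord (nth 0 p a)); split.
  apply: injF_bij => a b /(congr1 val); rewrite /= !inordK ?np // => e.
  by apply/val_inj/eqP; rewrite -(nth_uniq 0 _ _ up) ?sp ?e ?eqxx ?ltn_ord.
move=> a b; rewrite !inordK ?np //.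
have := tE a b (ltn_ord a) (ltn_ord b); rewrite !inord_val => <-.
move/allP: rp => /(_ (val a)); rewrite mem_iota add0n ltn_ord => /(_ isT).
by move/allP => /(_ (val b)); rewrite mem_iota add0n ltn_ord => /(_ isT)/eqP.
Qed.

Lemma ramsey33 (h : nat) (hE : rel 'I_h) :
  symmetric hE -> 5 < h -> has_homogeneous hE.
Proof.
move=> hsym h5.
have [t tP] : exists t : 'I_6 -> 'I_h, injective t.
  by exists (widen_ord h5) => a b /(congr1 val) /= e; apply: val_inj.
pose A v := [set i : 'I_6 | (i != ord0) && (hE (t ord0) (t i) == v)].
have [v] : exists v, 2 < #|A v|.
  have : #|A true| + #|A false| = 5.
    rewrite -cardsUI (_ : A true :&: A false = set0); last first.
      by apply/setP => i; rewrite !inE; case: (hE _ _); rewrite ?andbF.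
    rewrite cards0 addn0 (_ : _ :|: _ = ~: [set ord0]).
      by have := cardsC [set (ord0 : 'I_6)]; rewrite cards1 card_ord => -[].
    by apply/setP => i; rewrite !inE -andb_orr; case: (hE _ _); rewrite andbT.
  move=> s; case: (ltnP 2 #|A true|) => c; first by exists true.
  by exists false; lia.
case/card_gt2P => [i [j [k [[iA jA kA] [ij jk ki]]]]].
move: iA jA kA; rewrite !inE => /andP[i0 /eqP iv] /andP[j0 /eqP jv] /andP[k0 /eqP kv].
have tn a b : a != b -> t a != t b by apply: contra_neq => /tP.
have g a b : hE (t ord0) (t a) = v -> hE (t ord0) (t b) = v -> a != ord0 -> b != ord0 ->
    a != b -> hE (t a) (t b) = v -> has_homogeneous hE.
  move=> av bv a0 b0 ab e; exists v, (t ord0), (t a), (t b).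
  by split; rewrite ?tn // eq_sym.
case: (eqVneq (hE (t i) (t j)) v) => [|nij]; first exact: g.
case: (eqVneq (hE (t j) (t k)) v) => [|njk]; first exact: g.
case: (eqVneq (hE (t i) (t k)) v) => [|nik]; first by apply: g; rewrite // eq_sym.
exists (~~ v), (t i), (t j), (t k); split; rewrite ?tn // 1?eq_sym //.
by split; [move: nij|move: njk|move: nik]; case: (hE _ _); case: (v).
Qed.

Lemma homogeneous_gadget (h : nat) (hE : rel 'I_h) :
  symmetric hE -> irreflexive hE -> has_homogeneous hE -> gadget hE.
Proof.
move=> hsym hirr [[] [a [b [c [ab bc ac [eab ebc eac]]]]]].
  exact: (triangle_gadget hsym hirr eab ebc eac).
apply: gadget_compl; apply: (@triangle_gadget _ _ a b c).
- by move=> x y; rewrite /co_rel eq_sym hsym.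
- by move=> x; rewrite /co_rel eqxx.
- by rewrite /co_rel ab eab.
- by rewrite /co_rel bc ebc.
- by rewrite /co_rel ac eac.
Qed.

Lemma hard_gadget (h : nat) (hE : rel 'I_h) :
  symmetric hE -> irreflexive hE -> 2 < h ->
  ~ (graph_iso hE (@path_rel 3) \/ graph_iso hE (@copath_rel 3)
      \/ graph_iso hE (@path_rel 4)) -> gadget hE.
Proof.
move=> hsym hirr h3 ex.
case: (ltnP 5 h) => [|h5]; first by move/(ramsey33 hsym)/(homogeneous_gadget hsym hirr).
case: h h3 h5 hE hsym hirr ex => [|[|[|[|[|[|h]]]]]] // _ _ hE hsym hirr ex.
- case: (classified_sound hsym hirr classified3) => [|[T [<-|[<-|[]]] i]].
  + exact: homogeneous_gadget.
  + by case: ex; left.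
  + by case: ex; right; left.
- case: (classified_sound hsym hirr classified4) => [|[T [<-|[<-|[<-|[]]]] i]].
  + exact: homogeneous_gadget.
  + by case: ex; right; right.
  + exact: gadget_iso i cycle4_gadget.
  + apply: gadget_iso i _; apply: gadget_compl.
    have idi : graph_iso (co_rel (fun i j : 'I_4 => co_nat (cycle_nat 4) i j)) (@cycle_rel 4).
      exists id; split; first by exists id.
      move=> a b; rewrite /co_rel /co_nat /cycle_rel /cycle_nat.
      have [->|ab] := eqVneq a b; last by rewrite /= (_ : (a != b :> nat)) //= negbK.
      by case: b => [[|[|[|[|b]]]]].
    exact: gadget_iso idi cycle4_gadget.
- case: (classified_sound hsym hirr classified5) => [|[T [<-|[]] i]].
  + exact: homogeneous_gadget.
  + exact: gadget_iso i cycle5_gadget.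
Qed.

Lemma iso_embeds (h l : nat) (hE : rel 'I_h) (hE' : rel 'I_l) :
  graph_iso hE hE' -> embeds_in_p4 hE' -> embeds_in_p4 hE.
Proof.
move=> [f [fb fE]] [g [gi gE]]; exists (g \o f); split.
  by apply: inj_comp gi (bij_inj fb).
by move=> a b; rewrite fE gE.
Qed.

Lemma p3_embeds : embeds_in_p4 (@path_rel 3).
Proof.
exists (widen_ord (isT : 3 <= 4)); split=> [a b /(congr1 val) /= e|a b //].
exact: val_inj.
Qed.

Lemma copath3_embeds : embeds_in_p4 (@copath_rel 3).
Proof.
(* The edge of [copath_rel 3] joins 0 and 2, so the isolated vertex 1 goes to the far end 3 of the
   path. *)
exists (fun a => tnth [tuple @Ordinal 4 0 isT; @Ordinal 4 3 isT; @Ordinal 4 1 isT] a).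
by split=> -[[|[|[|a]]] //= la] [[|[|[|b]]] //= lb] //;
  first [move=> _; apply: val_inj | move/(congr1 val)].
Qed.

Theorem theorem5 (h : nat) (hE : rel 'I_h)
    (hsym : symmetric hE) (hirr : irreflexive hE) (h3 : (3 <= h)%N) :
  ((graph_iso hE (@path_rel 3) \/ graph_iso hE (@copath_rel 3)
      \/ graph_iso hE (@path_rel 4)) ->
    exists (q : nat -> nat) (c k N : nat),
      forall n, (N <= n)%N ->
        (q n <= c * (trunc_log 2 n).+1 ^ k)%N /\
        exists S, (S <= c * n * (trunc_log 2 n).+1 ^ k)%N /\
          exists A : salg n (q n) S, det_solves hE A)
  /\
  (~ (graph_iso hE (@path_rel 3) \/ graph_iso hE (@copath_rel 3)
      \/ graph_iso hE (@path_rel 4)) ->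
    exists c N : nat,
      forall n p S, (N <= n)%N -> (0 < p)%N ->
        rand_solves hE n p S -> (n ^ 2 <= c * p * S)%N).
Proof.
split.
  move=> H; apply: p4_like_easy; first exact: ltn_trans h3.
  case: H => [i|[i|i]]; apply: (iso_embeds i).
  - exact: p3_embeds.
  - exact: copath3_embeds.
  - by exists id; split.
by move=> ex; apply: gadget_hard => //; apply: hard_gadget.
Qed.
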